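(* Let $\Omega\subset\mathbb{R}^d$ be compact with a probability measure $\mu$, let $\mathbf{F}$ be a compact subset of $\mathcal{C}(\Omega)$, and let $2\le q\le p<\infty$. Let $B\ge1$ be a given constant. Then there exist two positive constants $c$, $C$, which may depend on $q,p$, such that $$\varrho_m^{lp}(\mathbf{F},L_p)\le C\,d_n^{NqB}(\mathbf{F},L_\infty)$$ provided $m\ge cB^pn^{p/q}(\log(2Bn))^3$ ($m,n$ positive integers).
   Context: $\mathcal{C}(\Omega)$ is the space of continuous functions on $\Omega$; $\|f\|_p:=\left(\int_\Omega|f|^p\,d\mu\right)^{1/p}$ and $\|f\|_\infty:=\max_{\mathbf{x}\in\Omega}|f(\mathbf{x})|$. Recovery algorithm: for points $\xi=\{\xi^j\}_{j=1}^m\subset\Omega$ (repetitions allowed) and a finite-dimensional space $X_N$ of functions, with equal weights $\mathbf{w}_m=(1/m,\dots,1/m)$, let $$\ell p\mathbf{w}_m(\xi,X_N)(f):=\operatorname*{arg\,min}_{u\in X_N}\left(\frac1m\sum_{\nu=1}^m|f(\xi^\nu)-u(\xi^\nu)|^p\right)^{1/p}$$ (a minimizer; any choice if it is not unique). Then $$\varrho_m^{lp}(\mathbf{F},L_p):=\inf_{\xi,\,X_N,\,N\le m}\ \sup_{f\in\mathbf{F}}\|f-\ell p\mathbf{w}_m(\xi,X_N)(f)\|_p,$$ where the infimum is over all $N$-dimensional subspaces $X_N\subset L_p(\Omega,\mu)$ with $N\le m$ and all collections $\xi$ of $m$ points in $\Omega$. Condition NqB: an $N$-dimensional subspace $X_N$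 (of continuous functions) satisfies Condition NqB, with $B\ge1$, if $|f(\mathbf{x})|\le BN^{1/q}\|f\|_q$ for all $\mathbf{x}\in\Omega$ and $f\in X_N$. The NqB-conditioned Kolmogorov width in the uniform norm is $$d_n^{NqB}(\mathbf{F},L_\infty):=\inf_{X_n}\ \sup_{f\in\mathbf{F}}\ \inf_{g\in X_n}\|f-g\|_\infty,$$ the infimum being over all $n$-dimensional subspaces $X_n$ satisfying Condition NqB (infimum over the empty set is $+\infty$). *)

(* Defs.v *)
From HB Require Import structures.
From mathcomp Require Import all_boot all_order all_algebra.
From mathcomp Require Import all_classical all_reals all_analysis.

Set Implicit Arguments.
Unset Strict Implicit.
Unset Printing Implicit Defensive.

Import Order.TTheory GRing.Theory Num.Theory.
Import numFieldNormedType.Exports.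

Local Open Scope classical_set_scope.
Local Open Scope ring_scope.

(* Functions on a compact set Omega of R^d are represented by functions on the
   whole of R^d of which only the values on Omega are ever used; a measure on
   Omega is a Borel measure mu on R^d with mu Omega = 1. *)

Notation borelRn R d := (g_sigma_algebraType (@open 'rV[R]_d)).

Section Spaces.
Context {R : realType} {d : nat}.
Local Notation T := 'rV[R]_d.
Implicit Types (Omega : set T) (mu : probability (borelRn R d) R).
Implicit Types (f u : T -> R) (X F : set (T -> R)).

Definition Lp_norm mu Omega (p : R) f : \bar R :=
  ('N[mu]_(p%:E) [EFin \o (f \_ Omega)])%E.

Definition in_Lp mu Omega (p : R) f : Prop :=
  (f \_ Omega : borelRn R d -> R) \in Lfun mu p%:E.

Definition sup_norm Omega f : \bar R :=
  ereal_sup [set `|f x|%:E | x in Omega].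

Definition lincomb (N : nat) (e : 'I_N -> T -> R) (a : 'I_N -> R) : T -> R :=
  fun x => \sum_(i < N) a i * e i x.

Definition free_on Omega (N : nat) (e : 'I_N -> T -> R) : Prop :=
  forall a : 'I_N -> R,
    (forall x, Omega x -> lincomb e a x = 0) -> forall i, a i = 0.

Definition has_dim Omega (N : nat) X : Prop :=
  exists2 e : 'I_N -> T -> R, free_on Omega e & X = range (lincomb e).

(* The elements of X are genuine functions, since they are sampled at points.
   The last condition says that X embeds into the space L_p of classes of
   functions modulo equality mu-a.e., so N is its dimension there too. *)
Definition Lp_subspace mu Omega (p : R) (N : nat) X : Prop :=
  [/\ has_dim Omega N X,
      forall u, X u -> in_Lp mu Omega p u &
      forall u, X u -> Lp_norm mu Omega p u = 0%E ->
        forall x, Omega x -> u x = 0].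

Definition C_subspace Omega (N : nat) X : Prop :=
  has_dim Omega N X /\ forall u, X u -> {within Omega, continuous u}.

Definition NqB mu Omega (q B : R) (N : nat) X : Prop :=
  forall u, X u -> forall x, Omega x ->
    (`|u x|%:E <= (B * N%:R `^ q^-1)%:E * Lp_norm mu Omega q u)%E.

(* The topology of {uniform` Omega -> R} only sees restrictions to Omega, so
   this is compactness of the set of restrictions to Omega of the elements
   of F. *)
Definition compact_in_C Omega F : Prop :=
  (forall f, F f -> {within Omega, continuous f}) /\
  compact (F : set {uniform` Omega -> R}).

Definition dNqB mu Omega (q B : R) (n : nat) F : \bar R :=
  ereal_inf
    [set ereal_sup
      [set ereal_inf [set sup_norm Omega (f \- g) | g in X] | f in F]
    | X in [set X | C_subspace Omega n X /\ NqB mu Omega q B n X]].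

Definition empirical_error (p : R) (m : nat) (xi : 'I_m -> T) f u : R :=
  (m%:R^-1 * \sum_(j < m) `|f (xi j) - u (xi j)| `^ p) `^ p^-1.

Definition is_argmin (p : R) (m : nat) (xi : 'I_m -> T) X f u : Prop :=
  X u /\ forall v, X v ->
    empirical_error p xi f u <= empirical_error p xi f v.

(* A xi X f is a choice of the minimizer lpw_m(xi, X)(f). *)
Definition lpw Omega (p : R) (m : nat)
    (A : ('I_m -> T) -> set (T -> R) -> (T -> R) -> (T -> R)) : Prop :=
  forall (xi : 'I_m -> T) (N : nat) X f,
    (forall j, Omega (xi j)) -> has_dim Omega N X ->
    {within Omega, continuous f} -> is_argmin p xi X f (A xi X f).

Definition rho_lp mu Omega (p : R) (m : nat)
    (A : ('I_m -> T) -> set (T -> R) -> (T -> R) -> (T -> R)) F : \bar R :=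
  ereal_inf
    [set r | exists (xi : 'I_m -> T) (N : nat) (X : set (T -> R)),
      [/\ forall j, Omega (xi j), (0 < N <= m)%N, Lp_subspace mu Omega p N X &
          r = ereal_sup [set Lp_norm mu Omega p (f \- A xi X f) | f in F]]].

End Spaces.

(* Main.v *)
Require Import Defs.
From mathcomp Require Import all_boot all_order all_algebra.
From mathcomp Require Import all_classical all_reals all_analysis.
From mathcomp Require Import measurable_realfun ring lra.
Import Order.TTheory GRing.Theory Num.Theory.
Import numFieldNormedType.Exports.
Local Open Scope classical_set_scope.
Local Open Scope ring_scope.

Set Implicit Arguments.
Unset Strict Implicit.
Unset Printing Implicit Defensive.

(** A best [L_p] approximation on the sample recovers [f] as well as the width
    predicts as soon as the sample controls the [L_p] norm from below on the
    [n]-dimensional space [X]: if [|u|_p <= C0 * (mean over xi of |u|^p)^(1/p)]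
    for all [u] in [X], then for [g] in [X] at uniform distance [s] from [f] the
    minimizer is within a multiple of [s] of [g] on the sample, hence in [L_p],
    hence within a multiple of [s] of [f] ([recovery_error]).  So everything
    rests on a one-sided discretization of the [L_p] norm by [m] points
    ([sampling_discretization]).

    Put [K = 2^(p/q) B^p n^(p/q)].  Condition NqB and the comparison of the [L_q]
    and [L_p] norms give [|u x|^p <= K * (integral of |u|^p)] on [X]
    ([NqB_pintegral]), and [n <= K].  It is enough to have
    [m >= c K (1 + ln K)^2], because [ln K <= p * ln (2 B n)].

    Normalize [u] by [integral of |u|^p = 1], so that [|u|^p <= K], and split its
    range into about [ln K] dyadic levels.  It suffices to find points for which
    each level set [|u|^p > 2^k] that is not too rare, of measure at least
    [2^(-k) / (4 L)] with [L] the number of levels, receives a fixed proportion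
    of the points it deserves; the rare ones carry at most one quarter of the
    integral.  A Chernoff bound gives this for finitely many sets at once, so
    the functions have to be replaced by a net at uniform scale [2^(k/p)], and
    the union bound is affordable exactly when the logarithm of the size of the
    net is at most about [m 2^(-k) / L].

    The net comes from uniform convexity ([ball_cover]).  Starting from a
    shortest element of the unit ball, one repeatedly asks for a point where
    [u] and the current center differ by more than [t], cuts the ball
    accordingly, and passes to a shortest element of what remains.  By
    Clarkson's inequality ([clarkson]) every cut raises the [p]-th power of the
    norm of the center by at least [t^p / (2^p K)], so at most [2^p K / t^p] cuts
    occur.  Each cut is a point and a sign: over [M] candidate points the
    logarithm of the size of the net is [O(K t^(-p) ln M)], which is what is
    needed, up to a factor [ln M].

    The candidate points are a preliminary sample of size [M] polynomial in [K]
    ([crude_sampling]).  There a single net of the unit ball of [X], obtained by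
    elimination ([span_net]), and a single union bound suffice.  The points are
    always chosen one at a time by the method of conditional expectations
    ([simultaneous_chernoff]), which only requires that a finite combination of
    functions somewhere reaches its mean. *)

(** * Real powers *)

Lemma le_powRl (R : realType) (r x y : R) :
  0 <= r -> 0 <= x -> x <= y -> x `^ r <= y `^ r.
Proof.
move=> r0 x0 xy; apply: ge0_ler_powR => //; rewrite nnegrE //.
exact: le_trans xy.
Qed.

Lemma midpoint_powR (R : realType) (r a b : R) : 1 <= r -> 0 <= a -> 0 <= b ->
  ((a + b) / 2) `^ r <= (a `^ r + b `^ r) / 2.
Proof.
move=> r1 a0 b0.
have h0 : (0 : R) <= 2^-1 by lra.
have h1 : (2^-1 : R) <= 1 by lra.
pose t : {i01 R} := Itv01 h0 h1.
have := @convex_powR R r r1 t a b.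
rewrite !inE /= !in_itv /= !andbT => /(_ a0 b0).
rewrite [X in _ <= X]convRE [X in X `^ _]convRE /= /unstable.onem.
have -> : 1 - 2^-1 = 2^-1 :> R by lra.
by rewrite -!mulrDr mulrC [leRHS]mulrC.
Qed.

Lemma powRD_le (R : realType) (r a b : R) : 1 <= r -> 0 <= a -> 0 <= b ->
  (a + b) `^ r <= 2 `^ (r - 1) * (a `^ r + b `^ r).
Proof.
move=> r1 a0 b0.
have ab0 : 0 <= (a + b) / 2 by lra.
have -> : a + b = 2 * ((a + b) / 2) by lra.
rewrite powRM //.
apply: le_trans (ler_wpM2l (powR_ge0 _ _) (midpoint_powR r1 a0 b0)) _.
rewrite -(@mulr_powRB1 R 2 r) //; last by lra.
by rewrite le_eqVlt; apply/orP; left; apply/eqP; field.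
Qed.

Lemma powRD_ge (R : realType) (r a b : R) : 1 <= r -> 0 <= a -> 0 <= b ->
  a `^ r + b `^ r <= (a + b) `^ r.
Proof.
move=> r1 a0 b0; have r0 : 0 < r by lra.
rewrite -(mulr_powRB1 a0 r0) -(mulr_powRB1 b0 r0).
rewrite -(@mulr_powRB1 R (a + b) r) ?addr_ge0 // mulrDl.
by apply: lerD; apply: ler_wpM2l => //; apply: le_powRl; lra.
Qed.

(** The parallelogram identity, followed by superadditivity and convexity of
    the power [p / 2]; summed over sample points it is the [p]-uniform
    convexity of the discrete [L_p] norm. *)
Lemma clarkson (R : realType) (p a b : R) : 2 <= p ->
  `|(a + b) / 2| `^ p + `|(a - b) / 2| `^ p <= (`|a| `^ p + `|b| `^ p) / 2.
Proof.
move=> p2.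
have sqE (x : R) : `|x| `^ p = (x ^+ 2) `^ (p / 2).
  have {1}-> : p = 2%:R * (p / 2) by lra.
  by rewrite powRrM powR_mulrn // real_normK // num_real.
rewrite !sqE.
have h2 : 1 <= p / 2 by lra.
apply: le_trans (powRD_ge h2 (sqr_ge0 _) (sqr_ge0 _)) _.
apply: le_trans (midpoint_powR h2 (sqr_ge0 _) (sqr_ge0 _)).
by rewrite le_eqVlt; apply/orP; left; apply/eqP; congr (_ `^ _); field.
Qed.

Lemma powR_inv (R : realType) (a r : R) : 0 <= a -> a^-1 `^ r = (a `^ r)^-1.
Proof. by move=> a0; rewrite -powR_inv1 // -powRrM mulN1r powRN. Qed.

Lemma ler_indic (R : realType) (b c : bool) : (b -> c) -> b%:R <= c%:R :> R.
Proof. by case: b c => [] [] // /(_ isT). Qed.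

Lemma ln2_ge_half (R : realType) : 1 / 2 <= ln 2 :> R.
Proof.
rewrite -ler_expR lnK ?posrE // -[1 / 2]opprK expRN invf_ple ?posrE ?expR_gt0 //.
have := expR_ge1Dx (- (1 / 2) : R); lra.
Qed.

(** * Choosing points by the method of conditional expectations *)

(** Here [y i] is a mean of [Y i], an integral or a finite average; the
    selection hypothesis says that a combination of the [Y i] somewhere reaches
    its mean.  The first point is chosen for the weights
    [w_i (1 - y_i / 2)^m], in which the [m] remaining factors have their
    expected values, so that the potential never exceeds its expectation. *)
Lemma potential_descent (R : realType) (T : Type) (D : set T) (I : finType)
    (P : pred I) (Y : I -> T -> R) (y : I -> R) :
  (forall i x, D x -> 0 <= Y i x <= 1) ->
  (forall i, y i <= 1) ->
  (forall w : I -> R, (forall i, 0 <= w i) ->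
     exists2 x, D x & \sum_(i | P i) w i * y i <= \sum_(i | P i) w i * Y i x) ->
  forall (m : nat) (w : I -> R), (forall i, 0 <= w i) ->
  exists2 xi : 'I_m -> T, (forall j, D (xi j)) &
    \sum_(i | P i) w i * \prod_(j < m) (1 - Y i (xi j) / 2) <=
    \sum_(i | P i) w i * (1 - y i / 2) ^+ m.
Proof.
move=> Y01 y1 sel; elim=> [|m IH] w w0.
  have [x Dx _] := sel w w0.
  by exists (fun=> x) => //; apply: ler_sum => i _; rewrite big_ord0.
have q0 i : 0 <= 1 - y i / 2 by have := y1 i; lra.
have w'0 i : 0 <= w i * (1 - y i / 2) ^+ m by rewrite mulr_ge0 // exprn_ge0.
have [x Dx hx] := sel _ w'0.
have v0 i : 0 <= w i * (1 - Y i x / 2).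
  by rewrite mulr_ge0 //; have /andP[] := Y01 i x Dx; lra.
have [xi Dxi hxi] := IH _ v0.
exists (fun j => if unlift ord0 j is Some k then xi k else x).
  by move=> j; case: unliftP.
rewrite [leLHS](_ : _ = \sum_(i | P i) w i * (1 - Y i x / 2) *
    \prod_(j < m) (1 - Y i (xi j) / 2)); last first.
  apply: eq_bigr => i _; rewrite big_ord_recl unlift_none mulrA; congr (_ * _).
  by apply: eq_bigr => j _; rewrite liftK.
apply: le_trans hxi _.
rewrite -subr_ge0 -sumrB.
rewrite [leRHS](_ : _ = (\sum_(i | P i) (w i * (1 - y i / 2) ^+ m) * Y i x -
   \sum_(i | P i) (w i * (1 - y i / 2) ^+ m) * y i) / 2); last first.
  rewrite -sumrB mulr_suml; apply: eq_bigr => i _; rewrite exprS.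
  set t := (1 - y i / 2) ^+ m; lra.
by rewrite divr_ge0 // subr_ge0.
Qed.

Lemma expRN_le_1B (R : realType) (s : R) : 0 <= s <= 1 -> expR (- s) <= 1 - s / 2.
Proof.
move=> /andP[s0 s1]; rewrite expRN.
have h := expR_ge1Dx s; have := expR_gt0 s => e0.
rewrite invf_ple ?posrE //; last by lra.
apply: le_trans h; rewrite invf_ple ?posrE; [|lra|lra].
rewrite -[_^-1]mul1r ler_pdivrMr; [nra|lra].
Qed.

(** The lower half of a Chernoff bound, simultaneous for all [i]: weighting
    the potential by [expR (m * y_i / 4)] makes each term at most 1. *)
Lemma simultaneous_chernoff (R : realType) (T : Type) (D : set T) (I : finType)
    (P : pred I) (Y : I -> T -> R) (y : I -> R) (m : nat) :
  (forall i x, D x -> 0 <= Y i x <= 1) ->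
  (forall i, y i <= 1) ->
  (forall w : I -> R, (forall i, 0 <= w i) ->
     exists2 x, D x & \sum_(i | P i) w i * y i <= \sum_(i | P i) w i * Y i x) ->
  \sum_(i | P i) expR (- (m%:R * y i / 4)) <= 1 ->
  exists2 xi : 'I_m -> T, (forall j, D (xi j)) &
    forall i, P i -> m%:R * y i / 4 <= \sum_(j < m) Y i (xi j).
Proof.
move=> Y01 y1 sel sum1.
have w0 i : 0 <= expR (m%:R * y i / 4) by exact: expR_ge0.
have [xi Dxi hxi] := potential_descent Y01 y1 sel m w0.
exists xi => // i Pi.
have prodE k : expR (- \sum_(j < m) Y k (xi j)) <=
    \prod_(j < m) (1 - Y k (xi j) / 2).
  rewrite -sumrN expR_sum; apply: ler_prod => j _.
  by rewrite expR_ge0 expRN_le_1B // Y01.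
have powE k : expR (m%:R * y k / 4) * (1 - y k / 2) ^+ m <=
    expR (- (m%:R * y k / 4)).
  have h : (1 - y k / 2) ^+ m <= expR (- (m%:R * y k / 2)).
    have -> : - (m%:R * y k / 2) = m%:R * - (y k / 2) by ring.
    rewrite expRM_natl; apply: lerXn2r; rewrite ?nnegrE ?expR_ge0 //.
      by have := y1 k; lra.
    exact: expR_ge1Dx.
  apply: le_trans (ler_wpM2l (expR_ge0 _) h) _.
  by rewrite -expRD ler_expR; lra.
have term k : 0 <= expR (m%:R * y k / 4) * \prod_(j < m) (1 - Y k (xi j) / 2).
  by rewrite mulr_ge0 ?expR_ge0 // (le_trans _ (prodE k)) ?expR_ge0.
have le1 : expR (m%:R * y i / 4) * expR (- \sum_(j < m) Y i (xi j)) <= 1.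
  apply: le_trans (ler_wpM2l (expR_ge0 _) (prodE i)) _.
  apply: le_trans sum1.
  apply: le_trans (ler_sum _ (fun k _ => powE k)).
  apply: le_trans hxi.
  by rewrite (bigD1 i) //= lerDl sumr_ge0.
by move: le1; rewrite -expRD -[leRHS]expR0 ler_expR; lra.
Qed.

(** * Nets of finite-dimensional spaces of bounded functions *)

Lemma lincomb_pivot (R : realType) (d n : nat)
    (e : 'I_n.+1 -> 'rV[R]_d -> R) (b : 'I_n.+1 -> R) (k : 'I_n -> R) x :
  lincomb e b x = (b ord0 + \sum_(j < n) b (lift ord0 j) * k j) * e ord0 x +
    lincomb (fun j x => e (lift ord0 j) x - k j * e ord0 x)
      (fun j => b (lift ord0 j)) x.
Proof.
rewrite /lincomb big_ord_recl mulrDl -addrA; congr (_ + _).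
rewrite mulr_suml -big_split /=; apply: eq_bigr => j _; ring.
Qed.

(** Newton-type elimination: subtracting multiples of one basis function makes
    all the others vanish at a point where it is nearly maximal, which bounds
    its coefficient and leaves one dimension less. *)
Lemma span_net (R : realType) (d n : nat) (D : set 'rV[R]_d)
    (e : 'I_n -> 'rV[R]_d -> R) (rho eps : R) :
  (forall i, exists b : R, forall x, D x -> `|e i x| <= b) ->
  0 < eps -> eps <= rho ->
  exists (I : finType) (v : I -> 'I_n -> R),
    #|I|%:R <= (9 * 6 ^+ n * (rho / eps)) ^+ n /\
    forall a, (forall x, D x -> `|lincomb e a x| <= rho) ->
      exists i, forall x, D x -> `|lincomb e a x - lincomb e (v i) x| <= eps.
Proof.
elim: n e rho eps => [|n IH] e rho eps be eps0 epsr.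
  exists unit, (fun _ _ => 0); split; first by rewrite card_unit expr0.
  move=> a _; exists tt => x _; rewrite /lincomb !big_ord0 subrr normr0.
  exact: ltW.
have r1 : 1 <= rho / eps by rewrite ler_pdivlMr // mul1r.
have rho0 : 0 < rho by apply: lt_le_trans epsr.
have p6 k : 1 <= 6 ^+ k :> R by rewrite exprn_ege1 //; lra.
have [e0|e0] := pselect (forall x, D x -> e ord0 x = 0).
  have [I [v [cI hI]]] := IH (fun j => e (lift ord0 j)) rho eps
    (fun j => be (lift ord0 j)) eps0 epsr.
  exists I, (fun i j => if unlift ord0 j is Some k then v i k else 0); split.
    apply: le_trans cI _; rewrite exprS.
    have h6 := p6 n.
    have h1 : 9 * 6 ^+ n * (rho / eps) <= 9 * 6 ^+ n.+1 * (rho / eps).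
      by rewrite exprS; nra.
    apply: le_trans (_ : (9 * 6 ^+ n.+1 * (rho / eps)) ^+ n <= _).
      by apply: lerXn2r; rewrite ?nnegrE //; nra.
    by apply: ler_peMl; [apply: exprn_ge0|]; have := p6 n.+1; nra.
  move=> a ha.
  have lE b x : D x -> lincomb e b x =
      lincomb (fun j => e (lift ord0 j)) (fun j => b (lift ord0 j)) x.
    by move=> Dx; rewrite /lincomb big_ord_recl e0 // mulr0 add0r.
  have [i hi] := hI (fun j => a (lift ord0 j))
    (fun x Dx => eq_ind _ (fun z => `|z| <= rho) (ha x Dx) _ (lE a x Dx)).
  exists i => x Dx; rewrite !lE //.
  have := hi x Dx; congr (`| _ - _ | <= _).
  by apply: eq_bigr => j _; rewrite liftK.
have [x0 Dx0 ex0] : exists2 x, D x & e ord0 x != 0.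
  apply: contra_notP e0 => /forall2NP h x Dx.
  by have [//|/negP] := h x; rewrite negbK => /eqP.
have [b0 hb0] := be ord0.
pose E : set R := [set `|e ord0 x| | x in D].
have ubE : has_ubound E by exists b0 => _ [x Dx <-]; exact: hb0.
have supE : has_sup E by split=> //; exists `|e ord0 x0|, x0.
pose s := sup E.
have es x : D x -> `|e ord0 x| <= s by move=> Dx; apply: ub_le_sup => //; exists x.
have s0 : 0 < s by apply: lt_le_trans (es x0 Dx0); rewrite normr_gt0.
have [_ [x1 Dx1 <-] hx1] := @sup_adherent _ E (s / 2) ltac:(lra) supE.
have {}hx1 : s / 2 <= `|e ord0 x1| by move: hx1; rewrite -/s; lra.
have ne1 : e ord0 x1 != 0 by rewrite -normr_gt0; lra.
pose k j := e (lift ord0 j) x1 / e ord0 x1.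
pose e' j x := e (lift ord0 j) x - k j * e ord0 x.
have be' j : exists b : R, forall x, D x -> `|e' j x| <= b.
  have [b hb] := be (lift ord0 j).
  exists (b + `|k j| * b0) => x Dx.
  apply: le_trans (ler_normB _ _) _; rewrite normrM.
  by apply: lerD; [exact: hb|apply: ler_wpM2l => //; exact: hb0].
have e2 : eps / 2 <= 3 * rho by lra.
have [I [v [cI hI]]] := IH e' (3 * rho) (eps / 2) be' ltac:(lra) e2.
pose h := eps / (2 * s).
have h0 : 0 < h by rewrite divr_gt0 //; lra.
pose N := Num.trunc (8 * (rho / eps)).
exists ('I_N.+1 * I)%type, (fun (ij : 'I_N.+1 * I) j =>
  if unlift ord0 j is Some l then v ij.2 l
  else ((ij.1 : nat)%:R * h - 2 * rho / s) - \sum_(l < n) v ij.2 l * k l).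
split.
  rewrite card_prod card_ord natrM exprS; apply: ler_pM => //.
    have : N%:R <= 8 * (rho / eps) by rewrite truncn_le; lra.
    by rewrite -natr1; have := p6 n.+1; nra.
  apply: le_trans cI _; rewrite le_eqVlt; apply/orP; left; apply/eqP.
  congr (_ ^+ _); rewrite exprS; field; lra.
move=> a ha; pose u := lincomb e a; pose c := u x1 / e ord0 x1.
have cE : c = a ord0 + \sum_(j < n) a (lift ord0 j) * k j.
  rewrite /c /u /lincomb big_ord_recl mulrDl mulfK //; congr (_ + _).
  by rewrite mulr_suml; apply: eq_bigr => j _; rewrite /k mulrA.
have uE x : u x = c * e ord0 x + lincomb e' (fun j => a (lift ord0 j)) x.
  by rewrite cE; exact: lincomb_pivot.
have cb : `|c| <= 2 * rho / s.
  rewrite /c normrM normfV ler_pdivrMr ?normr_gt0 //.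
  apply: le_trans (ha x1 Dx1) _; rewrite mulrAC ler_pdivlMr //; nra.
have hv x : D x -> `|lincomb e' (fun j => a (lift ord0 j)) x| <= 3 * rho.
  move=> Dx; have -> : lincomb e' (fun j => a (lift ord0 j)) x =
    u x - c * e ord0 x by rewrite uE addrC addKr.
  apply: le_trans (ler_normB _ _) _; rewrite normrM.
  have : `|c| * `|e ord0 x| <= 2 * rho / s * s.
    by apply: ler_pM => //; exact: es.
  rewrite divfK ?gt_eqF //; have := ha x Dx; rewrite -/u; lra.
have [i hi] := hI _ hv.
pose z := (c + 2 * rho / s) / h.
have /andP[cl cu] : - (2 * rho / s) <= c <= 2 * rho / s by rewrite -ler_norml.
have z0 : 0 <= z by apply: divr_ge0; lra.
have zN : (Num.trunc z < N.+1)%N.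
  rewrite ltnS le_truncn // /z ler_pdivrMr //.
  have -> : 8 * (rho / eps) * h = 4 * rho / s by rewrite /h; field; lra.
  by move: cu; rewrite -!mulrA; set w := rho * s^-1; lra.
exists (Ordinal zN, i) => x Dx /=.
have /andP[zl zu] := truncn_itv z0.
pose c' := (Num.trunc z)%:R * h - 2 * rho / s.
have zc : z * h = c + 2 * rho / s by rewrite /z divfK // gt_eqF.
have cc' : `|c - c'| <= h.
  rewrite ler_norml /c'.
  have : (Num.trunc z)%:R * h <= z * h by rewrite ler_pM2r.
  have : z * h <= (Num.trunc z).+1%:R * h by rewrite ler_pM2r // ltW.
  rewrite zc -natr1 mulrDl mul1r; lra.
have vE : lincomb e (fun j => if unlift ord0 j is Some l then v i l
    else c' - \sum_(l < n) v i l * k l) x =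
    c' * e ord0 x + lincomb e' (v i) x.
  rewrite (lincomb_pivot _ _ k) unlift_none; congr (_ * _ + _).
    rewrite [X in _ + X](_ : _ = \sum_(l < n) v i l * k l) ?subrK //.
    by apply: eq_bigr => j _; rewrite liftK.
  by apply: eq_bigr => j _; rewrite liftK.
rewrite vE -/u uE opprD addrACA -mulrBl.
apply: le_trans (ler_normD _ _) _; rewrite normrM.
have := hi x Dx.
have : `|c - c'| * `|e ord0 x| <= h * s by apply: ler_pM => //; exact: es.
have -> : h * s = eps / 2 by rewrite /h; field; lra.
lra.
Qed.

(** * Covering numbers from uniform convexity *)

Definition pmean (R : realType) (p : R) (m : nat) (u : 'I_m -> R) : R :=
  m%:R^-1 * \sum_(j < m) `|u j| `^ p.

Lemma pmean_ge0 (R : realType) (p : R) (m : nat) (u : 'I_m -> R) :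
  0 <= pmean p u.
Proof. by rewrite mulr_ge0 ?invr_ge0 // sumr_ge0 // => j _; exact: powR_ge0. Qed.

Lemma pmeanZ (R : realType) (p a : R) (m : nat) (u : 'I_m -> R) :
  pmean p (fun j => a * u j) = `|a| `^ p * pmean p u.
Proof.
rewrite /pmean mulrCA; congr (_ * _); rewrite mulr_sumr.
by apply: eq_bigr => j _; rewrite normrM powRM.
Qed.

Lemma pmean_clarkson (R : realType) (p : R) (m : nat) (u v : 'I_m -> R) : 2 <= p ->
  pmean p (fun j => (u j + v j) / 2) + pmean p (fun j => (u j - v j) / 2) <=
  (pmean p u + pmean p v) / 2.
Proof.
move=> p2; rewrite /pmean -!mulrDr -mulrA; apply: ler_wpM2l; first by rewrite invr_ge0.
rewrite -!big_split /= mulr_suml; apply: ler_sum => j _; exact: clarkson.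
Qed.

(** The sets to be cut are not assumed closed, so a shortest element need not
    exist; one that is shortest up to [eta] is good enough when [eta] is the
    gain of a cut. *)
Definition near_minimal (R : realType) (p eta : R) (M : nat) (A : set ('I_M -> R))
    (c : 'I_M -> R) : Prop :=
  A c /\ forall v, A v -> pmean p c <= pmean p v + eta.

Definition center (R : realType) (p eta : R) (M : nat) (A : set ('I_M -> R)) :
    'I_M -> R :=
  xget (fun=> 0) [set c | near_minimal p eta A c].

Definition cut (R : realType) (p eta t : R) (M : nat) (A : set ('I_M -> R))
    (jb : 'I_M * bool) : set ('I_M -> R) :=
  [set v | A v /\ t <= (-1) ^+ jb.2 * (v jb.1 - center p eta A jb.1)].

(** The most recent cut is the head of the list, so that the center used by a
    cut depends only on the cuts in the tail. *)
Definition region (R : realType) (p eta t : R) (M : nat) (W : set ('I_M -> R))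
    (s : seq ('I_M * bool)) : set ('I_M -> R) :=
  foldr (fun jb A => cut p eta t A jb) W s.

Lemma center_near_minimal (R : realType) (p eta : R) (M : nat)
    (A : set ('I_M -> R)) (u : 'I_M -> R) :
  0 < eta -> A u -> near_minimal p eta A (center p eta A).
Proof.
move=> eta0 Au; rewrite /center; case: xgetP => [c _ //|h]; exfalso.
pose E : set R := [set pmean p v | v in A].
have infE : has_inf E.
  by split; [exists (pmean p u), u|exists 0 => _ [v _ <-]; exact: pmean_ge0].
have [_ [c Ac <-] hc] := inf_adherent eta0 infE.
apply: (h c); split=> // v Av.
have : inf E <= pmean p v by apply: ge_inf; [case: infE|exists v].
by move: hc; lra.
Qed.

(** Each cut raises the least value of the [p]-th power of the norm by a fixed
    amount [eta]: the midpoint of the old center and a function beyond the cut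
    still lies in the old region, so by uniform convexity that function must be
    longer. *)
Lemma region_pmean (R : realType) (p K t eta : R) (M : nat) (W : set ('I_M -> R)) :
  2 <= p -> 0 < K -> 0 < t -> eta = t `^ p / (2 `^ p * K) ->
  (forall u v, W u -> W v -> W (fun j => (u j + v j) / 2)) ->
  (forall u v, W u -> W v -> forall j,
     `|u j - v j| `^ p <= K * pmean p (fun j => u j - v j)) ->
  forall s,
  [/\ forall u, region p eta t W s u -> W u,
      forall u v, region p eta t W s u -> region p eta t W s v ->
        region p eta t W s (fun j => (u j + v j) / 2) &
      forall u, region p eta t W s u -> (size s)%:R * eta <= pmean p u].
Proof.
move=> p2 K0 t0 etaE Wmid WK.
have P0 : 0 < 2 `^ p :> R by rewrite powR_gt0.
have eta0 : 0 < eta.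
  by rewrite etaE divr_gt0 ?mulr_gt0 ?powR_gt0.
elim=> [|[j b] s [IHW IHmid IHn]] /=.
  by split=> // u _; rewrite mul0r pmean_ge0.
split=> [u [/IHW]//|u v [Au ut] [Av vt]|u [Au ut]].
  split; first exact: IHmid.
  rewrite /= in ut vt *; set c := center _ _ _ in ut vt *.
  set e := (-1) ^+ b in ut vt *.
  have -> : e * ((u j + v j) / 2 - c j) = (e * (u j - c j) + e * (v j - c j)) / 2.
    by field.
  lra.
rewrite /= in ut; set c := center _ _ _ in ut.
have [Ac cmin] : near_minimal p eta (region p eta t W s) c.
  exact: center_near_minimal Au.
have h1 := pmean_clarkson u c p2.
have h2 := cmin _ (IHmid _ _ Au Ac).
have h3 := IHn _ (IHmid _ _ Au Ac).
suff h4 : eta <= pmean p (fun j => (u j - c j) / 2).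
  rewrite -natr1 mulrDl mul1r; lra.
have -> : (fun j => (u j - c j) / 2) = (fun j => 2^-1 * (u j - c j)).
  by apply/funext => i; rewrite mulrC.
rewrite pmeanZ etaE ger0_norm; last by lra.
rewrite powR_inv // invfM mulrA [leLHS]mulrAC mulrC; apply: ler_wpM2l.
  by rewrite invr_ge0 ltW.
rewrite ler_pdivrMr // mulrC; apply: le_trans (WK _ _ (IHW _ Au) (IHW _ Ac) j).
apply: le_powRl; [lra|lra|].
apply: le_trans ut _; apply: le_trans (ler_norm _) _.
by rewrite normrM normrX normrN1 expr1n mul1r.
Qed.

(** A function of the ball is located by repeatedly asking for a sample point
    where it differs from the current center by more than [t]; the norm cannot
    exceed 1, so fewer than [N] answers, each a point and a sign, suffice. *)
Lemma ball_cover (R : realType) (p K t : R) (M N : nat) (W : set ('I_M -> R)) :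
  2 <= p -> 0 < K -> 0 < t -> 2 `^ p * K < N%:R * t `^ p ->
  (forall u v, W u -> W v -> W (fun j => (u j + v j) / 2)) ->
  (forall u v, W u -> W v -> forall j,
     `|u j - v j| `^ p <= K * pmean p (fun j => u j - v j)) ->
  (forall u, W u -> pmean p u <= 1) ->
  exists v : seq (option ('I_M * bool)) -> 'I_M -> R,
    forall u, W u -> exists i : N.-tuple (option ('I_M * bool)),
      forall j, `|u j - v i j| <= t.
Proof.
move=> p2 K0 t0 hN Wmid WK W1.
have P0 : 0 < 2 `^ p :> R by rewrite powR_gt0.
pose eta : R := t `^ p / (2 `^ p * K).
have reg := region_pmean p2 K0 t0 (erefl eta) Wmid WK.
exists (fun s => center p eta (region p eta t W (pmap id s))) => u Wu.
apply: contrapT => /forallNP far.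
have [s [sN us]] : exists s, size s = N /\ region p eta t W s u.
  suff H k : (k <= N)%N -> exists s, size s = k /\ region p eta t W s u by exact: H.
  elim: k => [_|k IH kN]; first by exists [::].
  have [s [sk us]] := IH (ltnW kN).
  (* Shorter answers are padded with [None] to a tuple of the fixed length. *)
  pose i := map Some s ++ nseq (N - k) None.
  have iN : size i == N by rewrite size_cat size_map size_nseq sk subnKC // ltnW.
  have iE : pmap id i = s.
    rewrite /i pmap_cat; have -> : pmap id (nseq (N - k) None) = [::] :> seq ('I_M * bool).
      by elim: (N - k)%N.
    by rewrite cats0; apply: map_pK.
  have /existsNP[j /negP] := far (Tuple iN).
  rewrite /= iE -ltNge => hj.
  exists ((j, u j < center p eta (region p eta t W s) j) :: s); split => /=.
    by rewrite sk.
  split=> //=; apply: ltW; apply: lt_le_trans hj _.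
  case: ltP => hu /=.
    by rewrite expr1 mulN1r ltr0_norm ?subr_lt0.
  by rewrite expr0 mul1r ger0_norm ?subr_ge0.
have [_ _ /(_ u us)] := reg s; rewrite sN => hle.
have := le_trans hle (W1 u Wu).
rewrite /eta mulrA ler_pdivrMr ?mulr_gt0 // mul1r; lra.
Qed.

(** * Sampling a finite mean *)

(** Pointwise layer-cake bounds: the dyadic heights that a number exceeds
    recover it up to [1 / 2], and their sum is at most twice the number. *)
Lemma dyadic_upper (R : realType) (L : nat) (z : R) : z <= 2 ^+ L / 2 ->
  z <= 1 / 2 + \sum_(k < L) 2 ^+ k * (2 ^+ k / 2 < z)%R%:R.
Proof.
elim: L z => [|L IH] z; first by rewrite big_ord0 expr0 addr0.
rewrite big_ord_recr /= => hz.
have s0 : 0 <= \sum_(k < L) 2 ^+ k * (2 ^+ k / 2 < z)%R%:R :> R.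
  by rewrite sumr_ge0 // => k _; rewrite mulr_ge0 // exprn_ge0.
have [lz|zl] := ltP (2 ^+ L / 2) z.
  by move: hz s0; rewrite exprS mulr1; lra.
by rewrite mulr0 addr0; exact: IH.
Qed.

Lemma dyadic_lower (R : realType) (L : nat) (z : R) : 0 <= z ->
  \sum_(k < L) 2 ^+ k * (2 ^+ k < z)%R%:R <= 2 * z.
Proof.
move=> z0; elim: L => [|L IH]; first by rewrite big_ord0; lra.
rewrite big_ord_recr /=; have [lz|zl] := ltP (2 ^+ L) z; last by rewrite mulr0 addr0.
have h k : \sum_(i < k) 2 ^+ i * (2 ^+ i < z)%R%:R <= 2 ^+ k :> R.
  elim: k => [|k IHk]; first by rewrite big_ord0.
  rewrite big_ord_recr /= exprS.
  have : 2 ^+ k * (2 ^+ k < z)%R%:R <= 2 ^+ k :> R.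
    by rewrite ler_piMr // ?exprn_ge0 // lern1 leq_b1.
  lra.
rewrite mulr1; have := h L; lra.
Qed.

Lemma exists_ge_mean (R : realType) (M : nat) (g : 'I_M -> R) : (0 < M)%N ->
  exists j, M%:R^-1 * \sum_(i < M) g i <= g j.
Proof.
move=> M0; apply: contrapT => /forallNP h.
have : \sum_(i < M) g i < \sum_(i < M) M%:R^-1 * \sum_(i < M) g i.
  apply: ltr_sum; last by move=> j _; rewrite ltNge; apply/negP/h.
  by apply/hasP; exists (Ordinal M0) => //; rewrite mem_index_enum.
rewrite sumr_const card_ord -[X in _ < X]mulr_natl mulrA divff ?mul1r ?ltxx //.
by rewrite pnatr_eq0 -lt0n.
Qed.

(** For a normalized [u] and a level [t], a function [v] of the net with
    [|u - v| <= t / 4] satisfies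
    [|u| > t -> |v| > 3 t / 4 -> |u| > t / 2], so a sample that meets the
    level sets of the net meets those of [u] at half the height, at the price
    of a factor [2^p].  The Chernoff bound is applied to the level sets that are
    not too rare; the rare ones contribute at most one quarter to the mean.
    [N k] bounds the number of cuts at level [k]; the last hypothesis is the
    union bound, with [1 / L] available for each of the [L] levels. *)
Lemma finite_sampling (R : realType) (p K : R) (M m L : nat) (N : nat -> nat)
    (V : set ('I_M -> R)) :
  2 <= p -> 0 < K -> (0 < M)%N -> (0 < m)%N -> (0 < L)%N ->
  (forall a b u v, V u -> V v -> V (fun j => a * u j + b * v j)) ->
  (forall u, V u -> forall j, `|u j| `^ p <= K * pmean p u) ->
  K <= 2 ^+ L / 2 ->
  (forall k, (k < L)%N -> 2 * 8 `^ p * K < (N k)%:R * 2 ^+ k) ->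
  (forall k, (k < L)%N ->
     L%:R * (2 * M + 1)%:R ^+ N k * expR (- (m%:R / (16 * L%:R * 2 ^+ k))) <= 1 :> R) ->
  exists xi : 'I_m -> 'I_M, forall u, V u ->
    pmean p u <= 2 `^ (p + 6) * pmean p (fun i => u (xi i)).
Proof.
move=> p2 K0 M0 m0 L0 Vlin VK KL hN hm.
have p0 : 0 < p by lra.
have pn0 : p != 0 by rewrite gt_eqF.
have MR0 : 0 < M%:R :> R by rewrite ltr0n.
have mR0 : 0 < m%:R :> R by rewrite ltr0n.
have LR0 : 0 < L%:R :> R by rewrite ltr0n.
have e2 k : 0 < 2 ^+ k :> R by rewrite exprn_gt0.
pose W := [set u | V u /\ pmean p u <= 1].
pose t k : R := (2 ^+ k / 2) `^ p^-1.
have t0 k : 0 < t k by rewrite powR_gt0 // divr_gt0.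
have tp k : t k `^ p = 2 ^+ k / 2.
  by rewrite -powRrM mulVf // powRr1 // divr_ge0 // ltW.
have Wmid u v : W u -> W v -> W (fun j => (u j + v j) / 2).
  move=> [Vu u1] [Vv v1]; split.
    have := Vlin 2^-1 2^-1 _ _ Vu Vv; congr (V _).
    by apply/funext => j; rewrite -mulrDr mulrC.
  have := pmean_clarkson u v p2.
  have := pmean_ge0 p (fun j => (u j - v j) / 2); lra.
have WK u v : W u -> W v -> forall j,
    `|u j - v j| `^ p <= K * pmean p (fun j => u j - v j).
  move=> [Vu _] [Vv _] j; apply: (VK (fun j => u j - v j)).
  have := Vlin 1 (-1) _ _ Vu Vv; congr (V _).
  by apply/funext => i; rewrite mul1r mulN1r.
have W1 u : W u -> pmean p u <= 1 by case.
have tN k : (k < L)%N -> 2 `^ p * K < (N k)%:R * (t k / 4) `^ p.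
  move=> kL; have := hN k kL.
  have -> : 8 `^ p = 2 `^ p * 4 `^ p :> R by rewrite -powRM // -natrM.
  rewrite powRM ?invr_ge0 ?(ltW (t0 k)) // powR_inv // tp.
  have : 0 < 4 `^ p :> R by rewrite powR_gt0.
  set b := 4 `^ p => b0 h.
  rewrite !mulrA ltr_pdivlMr // ltr_pdivlMr //.
  apply: le_lt_trans h; rewrite le_eqVlt; apply/orP; left; apply/eqP; ring.
have cover (k : 'I_L) := ball_cover p2 K0 (divr_gt0 (t0 k) (ltr0n R 4))
  (tN k (ltn_ord k)) Wmid WK W1.
have [v hv] := choice cover.
pose I := {k : 'I_L & (N k).-tuple (option ('I_M * bool))}.
pose Y (i : I) (j : 'I_M) : R := (3 / 4 * t (tag i) < `|v (tag i) (tagged i) j|)%R%:R.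
pose y (i : I) : R := M%:R^-1 * \sum_(j < M) Y i j.
pose alpha k : R := (4 * L%:R * 2 ^+ k)^-1.
have Y01 i j : 0 <= Y i j <= 1 by rewrite /Y ler0n lern1 leq_b1.
have y1 i : y i <= 1.
  rewrite /y ler_pdivrMl // mulr1.
  apply: le_trans (_ : \sum_(j < M) 1 <= _).
    by apply: ler_sum => j _; have /andP[] := Y01 i j.
  by rewrite sumr_const card_ord.
pose P := [pred i : I | alpha (tag i) <= y i].
have sel (w : I -> R) : (forall i, 0 <= w i) ->
    exists2 j, setT j & \sum_(i | P i) w i * y i <= \sum_(i | P i) w i * Y i j.
  move=> _.
  have [j hj] := exists_ge_mean (fun j => \sum_(i | P i) w i * Y i j) M0.
  exists j => //; apply: le_trans hj; rewrite exchange_big mulr_sumr.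
  rewrite le_eqVlt; apply/orP; left; apply/eqP; apply: eq_bigr => i _.
  by rewrite /y mulrCA mulr_sumr.
have sum1 : \sum_(i | P i) expR (- (m%:R * y i / 4)) <= 1.
  apply: le_trans (_ : \sum_(i : I) expR (- (m%:R * alpha (tag i) / 4)) <= _).
    rewrite big_mkcond /=; apply: ler_sum => i _.
    case: ifP => [Pi|_]; last exact: expR_ge0.
    rewrite ler_expR lerN2 ler_pM2r ?invr_gt0 // ler_pM2l //.
  pose F (k : 'I_L) (_ : (N k).-tuple (option ('I_M * bool))) : R :=
    expR (- (m%:R * alpha k / 4)).
  rewrite -(@sig_big_dep _ _ _ _ _ xpredT (fun _ => xpredT) F) /=.
  apply: le_trans (_ : \sum_(k < L) L%:R^-1 <= _); last first.
    by rewrite sumr_const card_ord -[leLHS]mulr_natl divff // gt_eqF.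
  apply: ler_sum => k _; rewrite sumr_const card_tuple card_option card_prod.
  rewrite card_ord card_bool -[leLHS]mulr_natl natrX.
  have := hm k (ltn_ord k); rewrite addn1 mulnC -mulrA -ler_pdivlMl // mulr1.
  congr (_ * expR (- _) <= _).
  rewrite /alpha; field.
  by rewrite !gt_eqF.
have [xi _ hxi] := simultaneous_chernoff (D := setT) (fun i x _ => Y01 i x) y1 sel sum1.
exists xi.
suff norm1 u : V u -> pmean p u = 1 -> 1 <= 2 `^ (p + 6) * pmean p (fun i => u (xi i)).
  move=> u Vu; have := pmean_ge0 p u; rewrite le_eqVlt => /orP[/eqP <-|u0].
    by rewrite mulr_ge0 ?powR_ge0 ?pmean_ge0.
  pose a := (pmean p u) `^ (- p^-1).
  have aE : `|a| `^ p = (pmean p u)^-1.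
    rewrite ger0_norm ?powR_ge0 // -powRrM mulNr mulVf // powR_inv1 //.
    exact: ltW.
  have Vau : V (fun j => a * u j).
    have := Vlin a 0 _ _ Vu Vu; congr (V _).
    by apply/funext => i; rewrite mul0r addr0.
  have := norm1 _ Vau; rewrite !pmeanZ aE mulVf ?gt_eqF // => /(_ erefl).
  by rewrite mulrCA mulrC ler_pdivlMr // mul1r.
move=> Vu u1.
have Wu : W u by split=> //; rewrite u1.
pose nu k : R := M%:R^-1 * \sum_(j < M) (2 ^+ k / 2 < `|u j| `^ p)%R%:R.
pose emp k : R := m%:R^-1 *
  \sum_(i < m) (2 ^+ k < 2 * 2 `^ p * `|u (xi i)| `^ p)%R%:R.
have nu_emp k : (k < L)%N -> nu k <= 4 * emp k + alpha k.
  move=> kL; have [i hi] := hv (Ordinal kL) u Wu.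
  pose ik : I := Tagged (fun k : 'I_L => (N k).-tuple (option ('I_M * bool))) i.
  have nuy : nu k <= y ik.
    rewrite /nu /y ler_pM2l ?invr_gt0 //; apply: ler_sum => j _.
    rewrite /Y; apply: ler_indic => hj.
    have : t k < `|u j|.
      rewrite ltNge; apply/negP => hle.
      by move: hj; rewrite -tp ltNge => /negP; apply; apply: le_powRl => //; exact: ltW.
    have : `|u j| - `|v (tag ik) (tagged ik) j| <= t k / 4.
      exact: le_trans (lerB_dist _ _) (hi j).
    rewrite -[t (tag ik)]/(t k); lra.
  have emp0 : 0 <= emp k.
    by apply: mulr_ge0; [rewrite invr_ge0|exact: sumr_ge0].
  have [hP|hP] := leP (alpha k) (y ik); last by lra.
  have : m%:R * y ik / 4 <= m%:R * emp k.
    rewrite /emp mulVKf ?gt_eqF //; apply: le_trans (hxi ik hP) _.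
    apply: ler_sum => j _; rewrite /Y; apply: ler_indic => hj.
    have ut : t k / 2 < `|u (xi j)|.
      have : `|v (tag ik) (tagged ik) (xi j)| - `|u (xi j)| <= t k / 4.
        by apply: le_trans (lerB_dist _ _) _; rewrite distrC; exact: hi.
      by move: hj; rewrite -[t (tag ik)]/(t k); lra.
    have : (t k / 2) `^ p < `|u (xi j)| `^ p.
      by apply: gt0_ltr_powR; rewrite ?nnegrE ?divr_ge0 // ltW.
    rewrite powRM ?invr_ge0 ?(ltW (t0 k)) // powR_inv // tp.
    by rewrite ltr_pdivrMr ?powR_gt0 // ltr_pdivrMr //; nra.
  rewrite -mulrA ler_pM2l // => h.
  have : 0 < alpha k by rewrite invr_gt0 !mulr_gt0.
  lra.
have up : 1 <= 1 / 2 + \sum_(k < L) 2 ^+ k * nu k.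
  rewrite -[leLHS]u1 /pmean ler_pdivrMl // mulrDr.
  have -> : M%:R * \sum_(k < L) 2 ^+ k * nu k =
      \sum_(j < M) \sum_(k < L) 2 ^+ k * (2 ^+ k / 2 < `|u j| `^ p)%R%:R.
    rewrite exchange_big mulr_sumr; apply: eq_bigr => k _ /=.
    by rewrite /nu mulrCA mulVKf ?gt_eqF // mulr_sumr.
  have -> : M%:R * (1 / 2) = \sum_(j < M) (1 / 2) :> R.
    by rewrite sumr_const card_ord -[RHS]mulr_natl.
  rewrite -big_split /=; apply: ler_sum => j _; apply: dyadic_upper.
  by apply: le_trans KL; have := VK u Vu j; rewrite u1 mulr1.
have rare : \sum_(k < L) 2 ^+ k * alpha k = 1 / 4.
  rewrite (eq_bigr (fun=> (4 * L%:R)^-1)).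
    by rewrite sumr_const card_ord -[LHS]mulr_natl; field; rewrite gt_eqF.
  by move=> k _; rewrite /alpha; field; rewrite !gt_eqF.
have low : \sum_(k < L) 2 ^+ k * emp k <= 2 * (2 * 2 `^ p * pmean p (fun i => u (xi i))).
  rewrite -(ler_pM2l mR0).
  have -> : m%:R * \sum_(k < L) 2 ^+ k * emp k = \sum_(j < m) \sum_(k < L)
      2 ^+ k * (2 ^+ k < 2 * 2 `^ p * `|u (xi j)| `^ p)%R%:R.
    rewrite exchange_big mulr_sumr; apply: eq_bigr => k _ /=.
    by rewrite /emp mulrCA mulVKf ?gt_eqF // mulr_sumr.
  have -> : m%:R * (2 * (2 * 2 `^ p * pmean p (fun i => u (xi i)))) =
      \sum_(j < m) 2 * (2 * 2 `^ p * `|u (xi j)| `^ p).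
    by rewrite -!mulr_sumr /pmean; field; rewrite gt_eqF.
  apply: ler_sum => j _; apply: dyadic_lower.
  by rewrite !mulr_ge0 ?powR_ge0.
have : \sum_(k < L) 2 ^+ k * nu k <= \sum_(k < L) (4 * (2 ^+ k * emp k) + 2 ^+ k * alpha k).
  apply: ler_sum => k _; rewrite [X in _ <= X + _]mulrCA -mulrDr ler_pM2l //.
  exact: nu_emp.
rewrite big_split /= rare -mulr_sumr.
have -> : 2 `^ (p + 6) = 64 * 2 `^ p :> R.
  rewrite powRD; last by rewrite implybE pnatr_eq0 orbT.
  have -> : 2 `^ 6 = 64 :> R by rewrite powR_mulrn // -natrX.
  exact: mulrC.
lra.
Qed.

(** * Sampling an integral *)

(** A crude sample, of size polynomial in [K]: at the fixed scale [1 / 16] the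
    net of [span_net] has at most [expR (12 K^2)] elements, while the [p]-th
    powers of those close to the unit ball are at most [2^p K], so a union bound
    over the latter works.
    [J u] stands for the integral of [|u|^p]; the hypotheses on [J] are its
    homogeneity, its stability under uniform perturbations, the
    Nikol'skii-type inequality, and the fact that a combination of the functions
    [|u|^p] somewhere reaches its mean. *)
Lemma crude_sampling (R : realType) (d n M : nat) (p K : R) (D : set 'rV[R]_d)
    (e : 'I_n -> 'rV[R]_d -> R) (J : ('rV[R]_d -> R) -> R) :
  2 <= p -> 1 <= K -> n%:R <= K ->
  (forall i, exists b : R, forall x, D x -> `|e i x| <= b) ->
  (forall a, 0 <= J (lincomb e a)) ->
  (forall a c, J (lincomb e (fun i => c * a i)) = `|c| `^ p * J (lincomb e a)) ->
  (forall a b (eps : R), 0 <= eps ->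
     (forall x, D x -> `|lincomb e a x - lincomb e b x| <= eps) ->
     J (lincomb e a) <= 2 `^ (p - 1) * (J (lincomb e b) + eps `^ p)) ->
  (forall a x, D x -> `|lincomb e a x| `^ p <= K * J (lincomb e a)) ->
  (forall (I : finType) (a : I -> 'I_n -> R) (w : I -> R), (forall i, 0 <= w i) ->
     exists2 x, D x & \sum_i w i * J (lincomb e (a i)) <=
                      \sum_i w i * `|lincomb e (a i) x| `^ p) ->
  12 * 4 `^ (p + 1) * K ^+ 3 <= M%:R ->
  exists2 xi : 'I_M -> 'rV[R]_d, (forall j, D (xi j)) &
    forall a, J (lincomb e a) <=
      4 `^ (p + 1) * pmean p (fun j => lincomb e a (xi j)).
Proof.
move=> p2 K1 nK be J0 JZ Jle JK sel hM.
have p0 : 0 < p by lra.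
have p1 : 1 <= p by lra.
have pn0 : p != 0 by rewrite gt_eqF.
have K0 : 0 < K by lra.
have s0 : 0 <= 16^-1 :> R by rewrite invr_ge0.
pose g : R := (2 `^ p)^-1.
have two0 : 0 < 2 `^ p :> R by rewrite powR_gt0.
have g0 : 0 < g by rewrite invr_gt0.
have four_le : 4 <= 2 `^ p :> R.
  have -> : 4 = 2 `^ 2 :> R by rewrite powR_mulrn // -natrX.
  by apply: ler_powR; [lra|].
have g4 : g <= 4^-1 by rewrite lef_pV2 ?posrE //; lra.
have g1 : g <= 1 by lra.
(* All constants are powers of [2^p]; in terms of [g = 2^(-p)] the estimates
   below become polynomial. *)
have gE1 : 2 `^ (p - 1) = (2 * g)^-1.
  by rewrite powRB ?pnatr_eq0 ?implybT // powRr1 // invfM /g invrK mulrC.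
have gE16 : (16^-1 : R) `^ p = g ^+ 4.
  rewrite powR_inv // /g exprVn; congr (_^-1).
  have -> : 16 = 2 ^+ 4 :> R by rewrite -natrX.
  by rewrite -[2 ^+ 4]powR_mulrn // -powRrM mulrC powRrM powR_mulrn ?powR_ge0.
have gE4 : 4 `^ (p + 1) = 4 / g ^+ 2.
  rewrite powRD; last by rewrite implybE pnatr_eq0 orbT.
  rewrite powRr1 // mulrC /g exprVn invrK; congr (_ * _).
  have -> : 4 = 2 * 2 :> R by rewrite -natrM.
  by rewrite powRM // expr2.
pose rho := K `^ p^-1.
have rhop : rho `^ p = K by rewrite -powRrM mulVf // powRr1 // ltW.
have rho1 : 1 <= rho.
  have <- : 1 `^ p^-1 = 1 :> R by rewrite powR1.
  by apply: le_powRl => //; rewrite invr_ge0 ltW.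
have rhoK : rho <= K.
  by apply: ler1_powR => //; rewrite invf_le1 //; lra.
have [I [v [cI hv]]] := @span_net R d n D e rho (16^-1) be ltac:(lra) ltac:(lra).
pose P (i : I) := `[< g <= J (lincomb e (v i)) /\
  forall x, D x -> `|lincomb e (v i) x| <= 2 * rho >].
(* Far elements of the net are replaced by 0, to keep [Y] in the unit
   interval; the bounds are only claimed for those in [P]. *)
pose v' i : 'I_n -> R := if P i then v i else fun=> 0.
have v'b i x : D x -> `|lincomb e (v' i) x| `^ p <= 2 `^ p * K.
  move=> Dx; rewrite -rhop -powRM //; last by lra.
  apply: le_powRl => //; first exact: ltW.
  rewrite /v'; case: ifPn => [/asboolP[_]|_]; first exact.
  by rewrite /lincomb big1 ?normr0 ?mulr_ge0 //; [lra|move=> j _; rewrite mul0r].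
have PK0 : 0 < 2 `^ p * K by rewrite mulr_gt0.
pose Y (i : I) x := `|lincomb e (v' i) x| `^ p / (2 `^ p * K).
pose y (i : I) := J (lincomb e (v' i)) / (2 `^ p * K).
have Y01 i x : D x -> 0 <= Y i x <= 1.
  move=> Dx; rewrite /Y divr_ge0 ?powR_ge0 ?(ltW PK0) //=.
  by rewrite ler_pdivrMr // mul1r v'b.
have y1 i : y i <= 1.
  have [x Dx] := sel unit (fun=> v' i) (fun=> 1) (fun=> ler01).
  rewrite !big_const !iter_addr_0 !card_unit !mul1r !mulr1n => h.
  by rewrite /y ler_pdivrMr // mul1r; apply: le_trans h (v'b i x Dx).
have selY (w : I -> R) : (forall i, 0 <= w i) ->
    exists2 x, D x & \sum_(i | P i) w i * y i <= \sum_(i | P i) w i * Y i x.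
  move=> w0.
  have w'0 i : 0 <= (if P i then w i else 0) by case: ifP.
  have [x Dx hx] := sel I v' _ w'0.
  exists x => //; rewrite /y /Y !(eq_bigr _ (fun i _ => mulrA _ _ _)) -!mulr_suml.
  rewrite ler_pM2r ?invr_gt0 //; move: hx.
  rewrite [X in X <= _ -> _](_ : _ = \sum_(i | P i) w i * J (lincomb e (v' i))).
    rewrite [X in _ <= X -> _](_ : _ =
      \sum_(i | P i) w i * `|lincomb e (v' i) x| `^ p) //.
    by rewrite [RHS]big_mkcond; apply: eq_bigr => i _; case: ifP; rewrite ?mul0r.
  by rewrite [RHS]big_mkcond; apply: eq_bigr => i _; case: ifP; rewrite ?mul0r.
have ex (k : nat) : 2 ^+ k <= expR k%:R :> R.
  rewrite -[k%:R]mulr1 expRM_natl; apply: lerXn2r; rewrite ?nnegrE ?expR_ge0 //.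
  have := expR_ge1Dx (1 : R); lra.
have cIe : #|I|%:R <= expR (12 * K ^+ 2).
  apply: le_trans cI _; rewrite invrK.
  have e9 : 9 <= expR 4%:R :> R by apply: le_trans (ex 4%N); rewrite -natrX ler_nat.
  have e16 : 16 <= expR 4%:R :> R by apply: le_trans (ex 4%N); rewrite -natrX ler_nat.
  have e6 : 6 ^+ n <= expR (n%:R * 3%:R) :> R.
    rewrite expRM_natl; apply: lerXn2r; rewrite ?nnegrE ?expR_ge0 //.
    by apply: le_trans (ex 3%N); rewrite -natrX ler_nat.
  have eK : rho <= expR K.
    by apply: le_trans rhoK _; have := expR_ge1Dx K; lra.
  pose z : R := 4%:R; rewrite -/z in e9 e16.
  have base : 9 * 6 ^+ n * (rho * 16) <= expR (z + n%:R * 3%:R + (K + z)).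
    have ee : expR (z + n%:R * 3%:R + (K + z)) =
        expR z * expR (n%:R * 3%:R) * (expR K * expR z) by rewrite -!expRD.
    rewrite ee; apply: ler_pM; [| |apply: ler_pM|apply: ler_pM] => //.
    - by lra.
    - by lra.
  apply: le_trans (_ : expR (n%:R * (z + n%:R * 3%:R + (K + z))) <= _).
    rewrite expRM_natl; apply: lerXn2r; rewrite ?nnegrE ?expR_ge0 //.
    by rewrite !mulr_ge0 ?exprn_ge0 //; lra.
  rewrite ler_expR /z; have : 0 <= n%:R :> R by [].
  set N := n%:R in nK *; nra.
have sum1 : \sum_(i | P i) expR (- (M%:R * y i / 4)) <= 1.
  apply: le_trans (_ : \sum_(i : I) expR (- (12 * K ^+ 2)) <= _).
    rewrite big_mkcond /=; apply: ler_sum => i _.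
    case: ifPn => [Pi|_]; last exact: expR_ge0.
    rewrite ler_expR lerN2 /y /v' Pi.
    have /asboolP[gJ _] := Pi.
    apply: le_trans (_ : 12 * 4 `^ (p + 1) * K ^+ 3 * (g / (2 `^ p * K)) / 4 <= _).
      rewrite gE4 -[2 `^ p]invrK -/g le_eqVlt; apply/orP; left; apply/eqP.
      by field; rewrite !gt_eqF.
    rewrite ler_pM2r ?invr_gt0 //; apply: ler_pM => //.
    - by rewrite !mulr_ge0 ?powR_ge0 ?exprn_ge0 // ltW.
    - by rewrite divr_ge0 // ltW.
    - by rewrite ler_pM2r ?invr_gt0.
  by rewrite sumr_const -[leLHS]mulr_natl expRN ler_pdivrMr ?expR_gt0 // mul1r.
have [xi Dxi hxi] := simultaneous_chernoff Y01 y1 selY sum1.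
exists xi => //.
have M0 : 0 < M%:R :> R.
  by apply: lt_le_trans hM; rewrite !mulr_gt0 ?powR_gt0 ?exprn_gt0.
suff norm1 a : J (lincomb e a) = 1 ->
    1 <= 4 `^ (p + 1) * pmean p (fun j => lincomb e a (xi j)).
  move=> a; have := J0 a; rewrite le_eqVlt => /orP[/eqP <-|a0].
    by rewrite mulr_ge0 ?powR_ge0 ?pmean_ge0.
  pose c := (J (lincomb e a)) `^ (- p^-1).
  have cE : `|c| `^ p = (J (lincomb e a))^-1.
    by rewrite ger0_norm ?powR_ge0 // -powRrM mulNr mulVf // powR_inv1.
  have := norm1 (fun i => c * a i); rewrite JZ cE mulVf ?gt_eqF // => /(_ erefl).
  have -> : (fun j => lincomb e (fun i => c * a i) (xi j)) =
      fun j => c * lincomb e a (xi j).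
    apply/funext => j; rewrite /lincomb mulr_sumr.
    by apply: eq_bigr => i _; rewrite mulrA.
  by rewrite pmeanZ cE mulrCA mulrC ler_pdivlMr // mul1r.
move=> Ja.
have ab x : D x -> `|lincomb e a x| <= rho.
  move=> Dx; rewrite leNgt; apply/negP => lt.
  have := JK a x Dx; rewrite Ja mulr1 -rhop leNgt => /negP; apply.
  by apply: gt0_ltr_powR; rewrite ?nnegrE //; lra.
have [i hi] := hv a ab.
have Jv : g <= J (lincomb e (v i)).
  have := Jle a (v i) (16^-1) s0 hi.
  rewrite Ja gE1 gE16 mulrC ler_pdivlMr ?mulr_gt0 // mul1r.
  have : g ^+ 4 <= g by rewrite exprS ler_piMr ?(ltW g0) // exprn_ile1 // ltW.
  lra.
have Pi : P i.
  apply/asboolP; split=> // x Dx.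
  have h1 := hi x Dx; have h2 := ab x Dx.
  have := lerB_dist (lincomb e (v i) x) (lincomb e a x); rewrite distrC; lra.
have pv : g / 4 <= pmean p (fun j => lincomb e (v i) (xi j)).
  have := hxi i Pi; rewrite /y /Y /v' Pi -mulr_suml.
  rewrite mulrAC mulrA ler_pM2r ?invr_gt0 // => h.
  rewrite /pmean ler_pdivlMl //; apply: le_trans h.
  have -> : M%:R * (g / 4) = M%:R / 4 * g by ring.
  by rewrite ler_pM2l ?divr_gt0.
have pvu : pmean p (fun j => lincomb e (v i) (xi j)) <=
    (2 * g)^-1 * (pmean p (fun j => lincomb e a (xi j)) + g ^+ 4).
  have -> : g ^+ 4 = M%:R^-1 * \sum_(j < M) g ^+ 4.
    by rewrite sumr_const card_ord -[X in _ * X]mulr_natl mulKf // gt_eqF.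
  rewrite /pmean -mulrDr -big_split mulrCA ler_pM2l ?invr_gt0 // mulr_sumr.
  apply: ler_sum => j _; rewrite -gE1 -gE16 /=.
  apply: le_trans (powRD_le p1 (normr_ge0 _) s0).
  apply: (le_powRl (ltW p0) (normr_ge0 _)).
  have := hi _ (Dxi j); have := lerB_dist (lincomb e (v i) (xi j)) (lincomb e a (xi j)).
  rewrite distrC; lra.
have h := le_trans pv pvu; rewrite ler_pdivlMl ?mulr_gt0 // in h.
have h4 : g ^+ 4 <= g ^+ 2 / 4.
  have -> : g ^+ 4 = g ^+ 2 * g ^+ 2 by rewrite -exprD.
  apply: ler_wpM2l; first by rewrite exprn_ge0 // ltW.
  by apply: (le_trans _ g4); rewrite expr2 ler_piMr ?(ltW g0).
rewrite gE4 mulrAC ler_pdivlMr ?exprn_gt0 // mul1r.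
by move: h h4; clear; set G4 := g ^+ 4; rewrite expr2; lra.
Qed.

(** The crude sample is thinned out by [finite_sampling].  Its size [M] is
    polynomial in [K] and enters only through its logarithm, at most
    [a2 * (1 + ln K)]; the number of levels is at most [a1 * (1 + ln K)]. *)
Lemma sampling_discretization (R : realType) (p : R) : 2 <= p ->
  exists c C : R, [/\ 0 < c, 0 < C &
    forall (d n m : nat) (K : R) (D : set 'rV[R]_d)
      (e : 'I_n -> 'rV[R]_d -> R) (J : ('rV[R]_d -> R) -> R),
    1 <= K -> n%:R <= K -> (0 < m)%N ->
    (forall i, exists b : R, forall x, D x -> `|e i x| <= b) ->
    (forall a, 0 <= J (lincomb e a)) ->
    (forall a c, J (lincomb e (fun i => c * a i)) = `|c| `^ p * J (lincomb e a)) ->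
    (forall a b (eps : R), 0 <= eps ->
       (forall x, D x -> `|lincomb e a x - lincomb e b x| <= eps) ->
       J (lincomb e a) <= 2 `^ (p - 1) * (J (lincomb e b) + eps `^ p)) ->
    (forall a x, D x -> `|lincomb e a x| `^ p <= K * J (lincomb e a)) ->
    (forall (I : finType) (a : I -> 'I_n -> R) (w : I -> R), (forall i, 0 <= w i) ->
       exists2 x, D x & \sum_i w i * J (lincomb e (a i)) <=
                        \sum_i w i * `|lincomb e (a i) x| `^ p) ->
    c * K * (1 + ln K) ^+ 2 <= m%:R ->
    exists2 xi : 'I_m -> 'rV[R]_d, (forall j, D (xi j)) &
      forall a, J (lincomb e a) <= C * pmean p (fun j => lincomb e a (xi j))].
Proof.
move=> p2.
pose Q : R := 4 `^ (p + 1).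
have Q4 : 4 <= Q.
  have -> : 4 = 4 `^ 1 :> R by rewrite powRr1.
  by apply: ler_powR; lra.
have lnQ0 : 0 <= ln Q by apply: ln_ge0; lra.
pose A : R := 12 * Q.
pose a1 : R := 2 * ln Q + 4.
pose a2 : R := ln (2 * A + 3) + 3.
have lnA0 : 0 <= ln (2 * A + 3) by apply: ln_ge0; rewrite /A; lra.
pose E : R := 8 `^ p.
have E1 : 1 <= E.
  apply: le_trans (_ : 8 `^ 0 <= _); first by rewrite powRr0.
  by apply: ler_powR; lra.
have E0 : 0 <= E by lra.
have [a10 a20] : 0 < a1 /\ 0 < a2 by rewrite /a1 /a2; lra.
exists (16 * a1 * Q * (2 * a1 + 4 * E * a2)), (Q * 2 `^ (p + 6)).
split; [rewrite !mulr_gt0 //; nra|by rewrite mulr_gt0 ?powR_gt0 //; lra|].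
move=> d n m K D e J K1 nK m0 be J0 JZ Jle JK sel hm.
have K0 : 0 < K by lra.
have l0 : 0 <= ln K by apply: ln_ge0.
have K3 : 1 <= K ^+ 3 by rewrite exprn_ege1.
have AK0 : 0 <= A * K ^+ 3 by rewrite /A; nra.
have [M [M0 MA AM]] : exists M, [/\ (0 < M)%N, M%:R <= A * K ^+ 3 + 1 & A * K ^+ 3 <= M%:R].
  exists (Num.trunc (A * K ^+ 3)).+1; split=> //; last exact/ltW/truncnS_gt.
  by rewrite -natr1 lerD2r truncn_le.
have [xi Dxi hxi] := crude_sampling p2 K1 nK be J0 JZ Jle JK sel AM.
pose V := [set u | exists a, u = fun j => lincomb e a (xi j)].
pose K2 := Q * K.
have K24 : 4 <= K2 by rewrite /K2; nra.
have K20 : 0 < K2 by lra.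
pose x := ln K2 / ln 2.
have ln2 := ln2_ge_half R.
have x0 : 0 <= x.
  by rewrite divr_ge0 ?ln_ge0 //; lra.
have [k0 /andP[k0x xk0]] : exists k0 : nat, k0%:R <= x < k0.+1%:R.
  by exists (Num.trunc x); exact: truncn_itv.
pose L := k0.+2.
have K2E : K2 = 2 `^ x.
  rewrite /powR pnatr_eq0 /= /x divfK ?lnK ?posrE //.
  by rewrite gt_eqF //; lra.
have K2L : K2 <= 2 ^+ L / 2.
  rewrite exprS mulrAC divff ?mul1r ?pnatr_eq0 // K2E -powR_mulrn //.
  by apply: ler_powR; [lra|]; apply: ltW; exact: xk0.
have pow2 k : (k < L)%N -> 2 ^+ k <= 2 * K2.
  rewrite ltnS => kL; apply: le_trans (_ : 2 ^+ k0.+1 <= _).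
    exact: (ler_weXn2l (ler1n _ 2) kL).
  rewrite exprS ler_pM2l // K2E -powR_mulrn //; apply: ler_powR => //; lra.
have La1 : L%:R <= a1 * (1 + ln K).
  have : x <= 2 * (ln Q + ln K).
    rewrite /x /K2 lnM ?posrE //; last by lra.
    by rewrite ler_pdivrMr; nra.
  rewrite /L -!natr1 /a1; nra.
pose l : R := ln (2 * M + 1)%:R.
have l_a2 : l <= a2 * (1 + ln K).
  have MK : (2 * M + 1)%:R <= (2 * A + 3) * K ^+ 3.
    rewrite natrD natrM; lra.
  have : l <= ln ((2 * A + 3) * K ^+ 3).
    have AK : 0 < (2 * A + 3) * K ^+ 3.
      by rewrite mulr_gt0 ?exprn_gt0 // /A; lra.
    by rewrite ler_ln ?posrE // ltr0n addn1.
  rewrite lnM ?posrE ?exprn_gt0 //; last by rewrite /A; lra.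
  rewrite lnXn // -[ln K *+ 3]mulr_natl /a2 => h.
  by apply: le_trans h _; have := mulr_ge0 lnA0 l0; nra.
pose N k := (Num.trunc (2 * E * K2 / 2 ^+ k)).+1.
have e2 k : 0 < 2 ^+ k :> R by rewrite exprn_gt0.
have hN k : (k < L)%N -> 2 * 8 `^ p * K2 < (N k)%:R * 2 ^+ k.
  by move=> _; rewrite -ltr_pdivrMr //; exact: truncnS_gt.
have hNm k : (k < L)%N ->
    L%:R * (2 * M + 1)%:R ^+ N k * expR (- (m%:R / (16 * L%:R * 2 ^+ k))) <= 1 :> R.
  move=> kL.
  have L0 : 0 < L%:R :> R by rewrite ltr0n.
  apply: le_trans (_ : expR L%:R * expR ((N k)%:R * l) *
      expR (- (m%:R / (16 * L%:R * 2 ^+ k))) <= _).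
    rewrite ler_pM2r ?expR_gt0 // expRM_natl /l lnK ?posrE ?ltr0n ?addn1 //.
    rewrite ler_pM2r ?exprn_gt0 ?ltr0n //.
    have := expR_ge1Dx (L%:R : R); lra.
  rewrite -!expRD -[leRHS]expR0 ler_expR subr_le0 ler_pdivlMr ?mulr_gt0 //.
  have NE : (N k)%:R * 2 ^+ k <= 4 * E * K2.
    have : (Num.trunc (2 * E * K2 / 2 ^+ k))%:R <= 2 * E * K2 / 2 ^+ k.
      rewrite truncn_le; apply: divr_ge0; last exact: ltW.
      exact: mulr_ge0 (mulr_ge0 (ler0n R 2) E0) (ltW K20).
    rewrite ler_pdivlMr // /N -natr1 mulrDl mul1r; have := pow2 k kL; nra.
  have l_ge0 : 0 <= l by apply: ln_ge0; rewrite ler1n addn1.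
  have -> : (L%:R + (N k)%:R * l) * (16 * L%:R * 2 ^+ k) =
    16 * L%:R * (L%:R * 2 ^+ k + (N k)%:R * 2 ^+ k * l) by ring.
  apply: le_trans hm.
  have -> : 16 * a1 * Q * (2 * a1 + 4 * E * a2) * K * (1 + ln K) ^+ 2 =
    16 * (a1 * (1 + ln K)) *
    (a1 * (1 + ln K) * (2 * K2) + 4 * E * K2 * (a2 * (1 + ln K))).
    by rewrite /K2; ring.
  apply: ler_pM.
  - by rewrite mulr_ge0 // ltW.
  - by rewrite addr_ge0 ?mulr_ge0 // ltW.
  - by rewrite ler_pM2l.
  - apply: lerD.
      by apply: ler_pM; [by []|exact: ltW|by []|exact: pow2].
    by apply: ler_pM; [rewrite mulr_ge0 // ltW|by []|by []|by []].
have Vlin a b u v : V u -> V v -> V (fun j => a * u j + b * v j).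
  move=> [u' ->] [v' ->]; exists (fun i => a * u' i + b * v' i).
  apply/funext => j; rewrite /lincomb !mulr_sumr -big_split /=.
  by apply: eq_bigr => i _; ring.
have VK u : V u -> forall j, `|u j| `^ p <= K2 * pmean p u.
  move=> [a ->] j; apply: le_trans (JK a _ (Dxi j)) _.
  by rewrite /K2 [Q * K]mulrC -mulrA ler_pM2l.
have [eta heta] :=
  finite_sampling p2 K20 M0 m0 (ltn0Sn _ : (0 < L)%N) Vlin VK K2L hN hNm.
exists (fun i => xi (eta i)) => // a.
apply: le_trans (hxi a) _; rewrite -mulrA ler_pM2l ?powR_gt0 //.
by apply: heta; exists a.
Qed.

(** * Continuous functions on a compact set of a probability space *)

Lemma compact_borel (R : realType) (d : nat) (Omega : set 'rV[R]_d) :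
  compact Omega -> measurable (Omega : set (borelRn R d)).
Proof.
move=> cO; rewrite -(setCK Omega); apply: measurableC.
apply: sub_sigma_algebra; rewrite /= openC.
by apply: compact_closed => //; exact: norm_hausdorff.
Qed.

Lemma within_continuous_borel (R : realType) (d : nat) (Omega : set 'rV[R]_d)
    (f : 'rV[R]_d -> R) : compact Omega -> {within Omega, continuous f} ->
  measurable_fun (Omega : set (borelRn R d)) f.
Proof.
move=> cO cf; apply: (measurability _ (RGenOpens.measurableE R)).
move=> _ [_ [a [b ->] <-]].
have /open_subspaceP[V oV VE] : open (f @^-1` `]a, b[ : set (subspace Omega)).
  by move/continuousP : cf; apply; exact: interval_open.
rewrite setIC -VE; apply: measurableI; last exact: compact_borel.
exact: sub_sigma_algebra.
Qed.

Lemma within_continuous_bounded (R : realType) (d : nat) (Omega : set 'rV[R]_d)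
    (f : 'rV[R]_d -> R) : compact Omega -> {within Omega, continuous f} ->
  exists b : R, forall x, Omega x -> `|f x| <= b.
Proof.
move=> cO cf; have /compact_bounded[b [_ hb]] := continuous_compact cf cO.
exists (b + 1) => x Ox; apply: (hb (b + 1)); last by exists x.
by rewrite ltrDl.
Qed.

Section Mean.
Context {R : realType} {d : nat}.
Variables (Omega : set 'rV[R]_d) (mu : probability (borelRn R d) R).
Hypotheses (cO : compact Omega) (muO : mu Omega = 1%E).

Definition pintegral (p : R) (f : 'rV[R]_d -> R) : R :=
  \int[mu]_(x in (Omega : set (borelRn R d))) (`|f x| `^ p).

Let mO : measurable (Omega : set (borelRn R d)) := compact_borel cO.

Let muO_lty : (mu Omega < +oo)%E.
Proof. by rewrite muO ltry. Qed.

Let mean_cst (r : R) : \int[mu]_(x in (Omega : set (borelRn R d))) r = r.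
Proof.
transitivity (r * fine (mu Omega)); first exact: Rintegral_cst.
by rewrite muO mulr1.
Qed.

Let integrable_cst (r : R) :
  mu.-integrable (Omega : set (borelRn R d)) (EFin \o (fun=> r)).
Proof. exact: finite_measure_integrable_cst. Qed.

Lemma integrable_pow (p : R) (f : 'rV[R]_d -> R) : 0 <= p ->
  {within Omega, continuous f} ->
  mu.-integrable (Omega : set (borelRn R d)) (EFin \o (fun x => `|f x| `^ p)).
Proof.
move=> p0 cf; apply: measurable_bounded_integrable => //.
  apply: (measurableT_comp (measurable_powR p)).
  apply: measurableT_comp => //; exact: within_continuous_borel.
have [b hb] := within_continuous_bounded cO cf.
exists (b `^ p); split; first exact: num_real.
move=> z bz x Ox; rewrite /= ger0_norm ?powR_ge0 //.
apply: le_trans (ltW bz); apply: le_powRl => //; exact: hb.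
Qed.

Lemma pintegral_ge0 (p : R) (f : 'rV[R]_d -> R) : 0 <= pintegral p f.
Proof. by apply: Rintegral_ge0 => x _; exact: powR_ge0. Qed.

Lemma pintegralZ (p c : R) (f : 'rV[R]_d -> R) : 0 <= p ->
  {within Omega, continuous f} ->
  pintegral p (fun x => c * f x) = `|c| `^ p * pintegral p f.
Proof.
move=> p0 cf; rewrite -RintegralZl //; last exact: integrable_pow.
by apply: eq_Rintegral => x _; rewrite normrM powRM.
Qed.

Lemma pintegral_le (p s : R) (f g : 'rV[R]_d -> R) : 1 <= p -> 0 <= s ->
  {within Omega, continuous f} -> {within Omega, continuous g} ->
  (forall x, Omega x -> `|f x - g x| <= s) ->
  pintegral p f <= 2 `^ (p - 1) * (pintegral p g + s `^ p).
Proof.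
move=> p1 s0 cf cg fg; have p0 : 0 <= p by lra.
have ig := integrable_pow p0 cg.
have isp := integrable_cst (s `^ p).
have iD : mu.-integrable (Omega : set (borelRn R d))
    (EFin \o (fun x => `|g x| `^ p + s `^ p)) := integrableD mO ig isp.
rewrite -[X in pintegral p g + X]mean_cst -RintegralD // -RintegralZl //.
apply: le_Rintegral => //; first exact: integrable_pow.
  exact: (integrableZl mO (2 `^ (p - 1)) iD).
move=> x Ox; apply: le_trans (powRD_le p1 _ s0) => //.
apply: le_powRl => //; have := fg x Ox; have := lerB_dist (f x) (g x); lra.
Qed.

(** An average is attained or exceeded: otherwise the positive function
    [mean - g] would have integral zero. *)
Lemma exists_ge_integral (g : 'rV[R]_d -> R) :
  mu.-integrable (Omega : set (borelRn R d)) (EFin \o g) ->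
  exists2 x, Omega x & \int[mu]_(x in (Omega : set (borelRn R d))) g x <= g x.
Proof.
move=> ig; apply: contrapT => /forall2NP no.
set c := \int[mu]_(x in _) g x in no.
have gc x : Omega x -> g x < c.
  by move=> Ox; have [//|/negP] := no x; rewrite -ltNge.
have ic := integrable_cst c.
have int0 : (\int[mu]_(x in (Omega : set (borelRn R d))) `|(c - g x)%:E| = 0)%E.
  rewrite (eq_integral (fun x : borelRn R d => (c - g x)%:E)); last first.
    by move=> x /set_mem Ox; rewrite gee0_abs // lee_fin subr_ge0 ltW // gc.
  have := @RintegralB _ _ _ mu _ _ _ mO ic ig.
  rewrite mean_cst subrr /Rintegral => h.
  by rewrite -[LHS]fineK ?h //; exact: (integrable_fin_num mO (integrableB mO ic ig)).
have mcg : measurable_fun (Omega : set (borelRn R d)) (fun x => (c - g x)%:E).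
  exact: (measurable_int mu (integrableB mO ic ig)).
have [N [mN N0 hN]] := (ae_eq_integral_abs mu mO mcg).1 int0.
have : (mu Omega <= mu N)%E.
  apply: le_measure; rewrite ?inE // => x Ox; apply: hN => /= /(_ Ox) [].
  by have := gc x Ox; lra.
by rewrite muO N0 lee_fin ler10.
Qed.

Lemma pintegral_select (p : R) (I : finType) (u : I -> 'rV[R]_d -> R) (w : I -> R) :
  0 <= p -> (forall i, {within Omega, continuous (u i)}) ->
  exists2 x, Omega x &
    \sum_i w i * pintegral p (u i) <= \sum_i w i * `|u i x| `^ p.
Proof.
move=> p0 cu.
pose G i x := w i * `|u i x| `^ p.
have iG i : mu.-integrable (Omega : set (borelRn R d)) (EFin \o G i).
  exact: (integrableZl mO (w i) (integrable_pow p0 (cu i))).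
have sE : EFin \o (fun x => \sum_i G i x) = fun x => (\sum_i (EFin \o G i) x)%E.
  by apply/funext => x /=; rewrite sumEFin.
have iS : mu.-integrable (Omega : set (borelRn R d)) (EFin \o (fun x => \sum_i G i x)).
  by rewrite sE; apply: integrable_sum.
have [x Ox hx] := exists_ge_integral iS; exists x => //.
apply: le_trans hx; rewrite le_eqVlt; apply/orP; left; apply/eqP.
apply: EFin_inj; rewrite fineK; last exact: integrable_fin_num.
rewrite -[RHS]/(\int[mu]_(x in Omega) (EFin \o (fun x => (\sum_i G i x)%R)) x)%E.
rewrite sE integral_sum // -sumEFin; apply: eq_bigr => i _.
rewrite -RintegralZl //; last exact: integrable_pow.
by rewrite fineK //; exact: (integrable_fin_num mO (iG i)).
Qed.

Lemma Lp_normE (p : R) (f : 'rV[R]_d -> R) : 0 < p -> {within Omega, continuous f} ->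
  Lp_norm mu Omega p f = ((pintegral p f) `^ p^-1)%:E.
Proof.
move=> p0 cf; rewrite /Lp_norm; have pn0 : p != 0 by rewrite gt_eqF.
rewrite -[LHS]poweRe1 ?Lnorm_ge0 // -(mulfV pn0) poweRrM poweR_Lnorm //.
rewrite -poweR_EFin; congr (_ `^ _)%E.
rewrite /pintegral /Rintegral fineK; last exact/integrable_fin_num/integrable_pow/cf/ltW.
rewrite [RHS]integral_mkcond; apply: eq_integral => x _.
rewrite /= !patchE; case: ifP => _ //.
by rewrite normr0 powR0.
Qed.

(** A crude substitute for Jensen's inequality: [|f|^q <= a^q + a^(q-p) |f|^p]
    pointwise, with [a] the [L_p] norm of [f]. *)
Lemma pintegral_exponent (p q : R) (f : 'rV[R]_d -> R) : 0 < q -> q <= p ->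
  {within Omega, continuous f} ->
  (pintegral q f) `^ (p / q) <= 2 `^ (p / q) * pintegral p f.
Proof.
move=> q0 qp cf; have p0 : 0 < p by apply: lt_le_trans qp.
have qn0 : q != 0 by rewrite gt_eqF.
have pn0 : p != 0 by rewrite gt_eqF.
have ip := integrable_pow (ltW p0) cf.
have iq := integrable_pow (ltW q0) cf.
have key a : 0 < a -> pintegral q f <= a `^ q + a `^ (q - p) * pintegral p f.
  move=> a0.
  have ic := integrable_cst (a `^ q).
  have iZ : mu.-integrable (Omega : set (borelRn R d))
      (EFin \o (fun x => a `^ (q - p) * `|f x| `^ p)).
    exact: (integrableZl mO (a `^ (q - p)) ip).
  rewrite -[X in X + _]mean_cst -RintegralZl // -RintegralD //.
  apply: le_Rintegral => //; first exact: (integrableD mO ic iZ).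
  move=> x Ox; have [fa|af] := leP `|f x| a.
    apply: le_trans (_ : a `^ q <= _); first by apply: le_powRl => //; exact: ltW.
    by rewrite lerDl mulr_ge0 ?powR_ge0.
  apply: le_trans (_ : a `^ (q - p) * `|f x| `^ p <= _); last first.
    by rewrite lerDr powR_ge0.
  have f0 : 0 < `|f x| by apply: lt_trans af.
  have -> : `|f x| `^ q = `|f x| `^ (q - p) * `|f x| `^ p.
    by rewrite -powRD ?subrK // gt_eqF ?implybT.
  rewrite ler_pM2r ?powR_gt0 // -[q - p]opprB !powRN lef_pV2 ?posrE ?powR_gt0 //.
  by apply: le_powRl; rewrite ?subr_ge0 // ltW.
have [J0|J0] := eqVneq (pintegral p f) 0.
  have q1 : pintegral q f <= 0.
    apply/ler_addgt0Pr => z z0; rewrite add0r.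
    have := key (z `^ q^-1) ltac:(by rewrite powR_gt0).
    by rewrite J0 mulr0 addr0 -powRrM mulVf // powRr1 // ltW.
  have -> : pintegral q f = 0 by apply/eqP; rewrite eq_le q1 pintegral_ge0.
  by rewrite J0 mulr0 powR0 // mulf_neq0 // invr_neq0.
have {}J0 : 0 < pintegral p f by rewrite lt_neqAle eq_sym J0 pintegral_ge0.
pose a := (pintegral p f) `^ p^-1.
have a0 : 0 < a by rewrite powR_gt0.
have ap : a `^ p = pintegral p f by rewrite -powRrM mulVf // powRr1 // ltW.
have := key a a0; rewrite -ap -powRD ?subrK; last by rewrite gt_eqF ?implybT.
have -> : a `^ q + a `^ q = 2 * a `^ q by rewrite mulr_natl.
move=> h; apply: le_trans (le_powRl _ (pintegral_ge0 _ _) h) _.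
  by rewrite divr_ge0 // ltW.
rewrite powRM; [|exact: ler0n|exact: powR_ge0].
by rewrite -[(a `^ q) `^ _]powRrM mulrCA mulfV // mulr1.
Qed.

End Mean.

(** * Recovery by discrete least deviations *)

Lemma NqB_pintegral (R : realType) (d n : nat) (Omega : set 'rV[R]_d)
    (mu : probability (borelRn R d) R) (p q B : R) (X : set ('rV[R]_d -> R)) u x :
  compact Omega -> mu Omega = 1%E -> 0 < q -> q <= p -> 0 <= B ->
  NqB mu Omega q B n X -> X u -> {within Omega, continuous u} -> Omega x ->
  `|u x| `^ p <= 2 `^ (p / q) * (B `^ p * n%:R `^ (p / q)) * pintegral Omega mu p u.
Proof.
move=> cO muO q0 qp B0 hN Xu cu Ox.
have p0 : 0 < p by apply: lt_le_trans qp.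
have := hN u Xu x Ox; rewrite (Lp_normE cO muO q0 cu) lee_fin => h.
have := le_powRl (ltW p0) (normr_ge0 _) h.
rewrite powRM ?mulr_ge0 ?powR_ge0 // powRM ?powR_ge0 // -!powRrM [q^-1 * p]mulrC.
move=> {}h; apply: le_trans h _.
rewrite [2 `^ _ * _]mulrC -[leRHS]mulrA; apply: ler_wpM2l; first by rewrite mulr_ge0 ?powR_ge0.
exact: pintegral_exponent.
Qed.

(** Both the integral and the sample mean of [|f - u|^p] are compared with those
    of [|g - u|^p], once through the uniform distance of [f] to [g], and once
    through the minimality of [u] on the sample. *)
Lemma recovery_error (R : realType) (d m : nat) (Omega : set 'rV[R]_d)
    (mu : probability (borelRn R d) R) (p C s : R) (xi : 'I_m -> 'rV[R]_d)
    (X : set ('rV[R]_d -> R)) (f g u : 'rV[R]_d -> R) :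
  compact Omega -> mu Omega = 1%E -> 1 <= p -> 0 < C -> 0 <= s -> (0 < m)%N ->
  (forall j, Omega (xi j)) ->
  {within Omega, continuous f} -> {within Omega, continuous g} ->
  {within Omega, continuous u} ->
  (pintegral Omega mu p (g \- u) <= C * pmean p (fun j => g (xi j) - u (xi j))) ->
  is_argmin p xi X f u -> X g -> (forall x, Omega x -> `|f x - g x| <= s) ->
  (Lp_norm mu Omega p (f \- u)%R <=
    ((2 `^ (p - 1) * (C * 2 `^ p + 1)) `^ p^-1 * s)%:E)%E.
Proof.
move=> cO muO p1 C0 s0 m0 Oxi cf cg cu hC [_ umin] Xg fg.
have p0 : 0 < p by lra.
have mR0 : 0 < m%:R :> R by rewrite ltr0n.
have cB (h k : 'rV[R]_d -> R) : {within Omega, continuous h} ->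
    {within Omega, continuous k} -> {within Omega, continuous (h \- k)}.
  by move=> ch ck x; apply: cvgB; [exact: ch|exact: ck].
rewrite (Lp_normE cO muO p0 (cB _ _ cf cu)) lee_fin.
have two0 : 0 < 2 `^ (p - 1) :> R by rewrite powR_gt0.
have twoE : 2 `^ p = 2 * 2 `^ (p - 1) :> R by rewrite mulr_powRB1.
have sE : s = (s `^ p) `^ p^-1 by rewrite -powRrM mulfV ?gt_eqF // powRr1.
rewrite {1}sE -powRM ?powR_ge0 //; last first.
  by rewrite mulr_ge0 ?(ltW two0) // addr_ge0 // mulr_ge0 ?powR_ge0 // ltW.
apply: le_powRl; rewrite ?invr_ge0 ?(ltW p0) ?pintegral_ge0 //.
have fgu : pintegral Omega mu p (f \- u) <=
    2 `^ (p - 1) * (pintegral Omega mu p (g \- u) + s `^ p).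
  apply: (pintegral_le cO muO p1 s0 (cB _ _ cf cu) (cB _ _ cg cu)) => x Ox.
  rewrite /=; have -> : f x - u x - (g x - u x) = f x - g x by ring.
  exact: fg.
have fu_s : pmean p (fun j => f (xi j) - u (xi j)) <= s `^ p.
  apply: le_trans (_ : pmean p (fun j => f (xi j) - g (xi j)) <= _).
    rewrite leNgt; apply/negP => lt; have := umin g Xg.
    rewrite /empirical_error leNgt => /negP; apply.
    by apply: gt0_ltr_powR; rewrite ?nnegrE ?invr_gt0 //; exact: pmean_ge0.
  rewrite /pmean ler_pdivrMl //.
  apply: le_trans (_ : \sum_(j < m) s `^ p <= _).
    by apply: ler_sum => j _; apply: le_powRl; rewrite ?fg // ltW.
  by rewrite sumr_const card_ord -[leLHS]mulr_natl.
have gu_s : pmean p (fun j => g (xi j) - u (xi j)) <= 2 `^ p * s `^ p.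
  apply: le_trans (_ : 2 `^ (p - 1) * (pmean p (fun j => f (xi j) - u (xi j)) + s `^ p) <= _).
    have -> : s `^ p = m%:R^-1 * \sum_(j < m) s `^ p.
      by rewrite sumr_const card_ord -[X in _ * X]mulr_natl mulKf // gt_eqF.
    rewrite /pmean -mulrDr -big_split mulrCA ler_pM2l ?invr_gt0 // mulr_sumr.
    apply: ler_sum => j _ /=; apply: le_trans (powRD_le p1 _ s0) => //.
    apply: le_powRl => //; first exact: ltW.
    have -> : g (xi j) - u (xi j) = f (xi j) - u (xi j) + (g (xi j) - f (xi j)) by ring.
    by apply: le_trans (ler_normD _ _) _; rewrite lerD2l distrC fg.
  by rewrite twoE [2 * _]mulrC -mulrA ler_pM2l // mulr_natl mulr2n lerD2r.
apply: le_trans fgu _; rewrite -mulrA ler_pM2l // mulrDl mul1r lerD2r.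
by apply: le_trans hC _; rewrite -mulrA ler_pM2l.
Qed.

Lemma ereal_inf_pMl (R : realType) (c : R) (x : \bar R) (S : set (\bar R)) :
  0 < c -> (forall y, S y -> (x <= c%:E * y)%E) -> (x <= c%:E * ereal_inf S)%E.
Proof.
move=> c0 h; rewrite -lee_pdivrMl //; apply: le_ereal_inf_tmp => y Sy.
by rewrite lee_pdivrMl // h.
Qed.

(** With [K = 2^(p/q) B^p n^(p/q)] one has [ln K <= p l] for [l = ln (2 B n)], so
    the stated sample size covers what the discretization asks for; the
    summand 8 ensures [n <= m].  Both use [l >= 1/2], to replace lower powers of
    [l] by [l^3]. *)
Lemma sample_size (R : realType) (p q B c0 : R) (n m : nat) :
  2 <= q -> q <= p -> 0 < c0 -> 1 <= B -> (0 < n)%N ->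
  (2 * (2 + p) ^+ 2 * 2 `^ (p / q) * c0 + 8) * B `^ p * n%:R `^ (p / q) *
    ln (2 * B * n%:R) ^+ 3 <= m%:R ->
  let K := 2 `^ (p / q) * (B `^ p * n%:R `^ (p / q)) in
  [/\ 1 <= K, n%:R <= K, (n <= m)%N & c0 * K * (1 + ln K) ^+ 2 <= m%:R].
Proof.
move=> hq hqp c00 B1 n0 hm.
have p0 : 0 < p by lra.
have q0 : 0 < q by lra.
pose b : R := 2 `^ (p / q).
have b0 : 0 < b by rewrite powR_gt0.
have nR1 : 1 <= n%:R :> R by rewrite ler1n.
pose k : R := B `^ p * n%:R `^ (p / q).
pose l : R := ln (2 * B * n%:R).
have pq1 : 1 <= p / q by rewrite ler_pdivlMr // mul1r.
have pqp : p / q <= p by rewrite ler_pdivrMr //; nra.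
have B1p : 1 <= B `^ p.
  by apply: le_trans (_ : B `^ 0 <= _); [rewrite powRr0|apply: ler_powR => //; exact: ltW].
have n1p : n%:R <= n%:R `^ (p / q) :> R.
  by apply: le_trans (_ : n%:R `^ 1 <= _); [rewrite powRr1|apply: ler_powR].
have nk : n%:R <= k by rewrite /k; nra.
have b1 : 1 <= b.
  by apply: le_trans (_ : 2 `^ 0 <= _); [rewrite powRr0|apply: ler_powR; lra].
have k0 : 0 < k by lra.
have Bgt0 : 0 < B by lra.
have ngt0 : 0 < n%:R :> R by lra.
have lnB0 : 0 <= ln B by apply: ln_ge0.
have lnn0 : 0 <= ln n%:R :> R by apply: ln_ge0.
have ln2 := ln2_ge_half R.
have lE : l = ln 2 + ln B + ln n%:R.
  by rewrite /l !lnM ?posrE ?mulr_gt0.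
have l_half : 1 / 2 <= l by rewrite lE; lra.
have l0 : 0 <= l by lra.
have p20 : 0 <= 2 + p by lra.
have [b_ge0 c_ge0 k_ge0] := And3 (ltW b0) (ltW c00) (ltW k0).
have {}hm : 2 * (2 + p) ^+ 2 * b * c0 * k * l ^+ 3 + 8 * k * l ^+ 3 <= m%:R.
  by move: hm; rewrite -/l -[_ * B `^ p * _]mulrA -/k !mulrDl.
have l2 : l ^+ 2 <= 2 * l ^+ 3 by rewrite [l ^+ 3]exprS; have := sqr_ge0 l; nra.
have l3 : 1 <= 8 * l ^+ 3.
  have h2 : 1 / 4 <= l ^+ 2 by rewrite expr2; nra.
  by rewrite exprS; nra.
have big0 : 0 <= 2 * (2 + p) ^+ 2 * b * c0 * k * l ^+ 3.
  exact: (mulr_ge0 (mulr_ge0 (mulr_ge0 (mulr_ge0 (mulr_ge0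
    (ler0n R 2) (sqr_ge0 _)) b_ge0) c_ge0) k_ge0) (exprn_ge0 3 l0)).
have nm : (n <= m)%N by rewrite -(ler_nat R); nra.
pose K := b * k.
have K1 : 1 <= K by rewrite /K; nra.
have nK : n%:R <= K by rewrite /K; nra.
have lnK : 1 + ln K <= (2 + p) * l.
  have -> : ln K = p / q * ln 2 + (p * ln B + p / q * ln n%:R).
    by rewrite /K /k /b !lnM ?posrE ?mulr_gt0 ?powR_gt0 // !ln_powR.
  have h1 : p / q * ln 2 <= p * ln 2 by apply: ler_wpM2r => //; lra.
  have h2 : p / q * ln n%:R <= p * ln n%:R by apply: ler_wpM2r.
  have h3 : p * l = p * ln 2 + p * ln B + p * ln n%:R by rewrite lE; ring.
  by rewrite mulrDl h3; lra.
have hmK : c0 * K * (1 + ln K) ^+ 2 <= m%:R.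
  have lnK0 : 0 <= 1 + ln K by rewrite addr_ge0 // ln_ge0.
  apply: le_trans (_ : c0 * K * ((2 + p) ^+ 2 * (2 * l ^+ 3)) <= _).
    apply: ler_wpM2l; first exact: mulr_ge0 c_ge0 (mulr_ge0 b_ge0 k_ge0).
    apply: le_trans (_ : ((2 + p) * l) ^+ 2 <= _).
      by apply: lerXn2r; rewrite ?nnegrE //; apply: le_trans lnK.
    by rewrite exprMn; apply: ler_wpM2l => //; exact: sqr_ge0.
  apply: le_trans hm; apply: le_trans (_ : 2 * (2 + p) ^+ 2 * b * c0 * k * l ^+ 3 <= _).
    by rewrite le_eqVlt; apply/orP; left; apply/eqP; rewrite /K; ring.
  by rewrite lerDl; nra.
by split.
Qed.

Theorem theorem4p8 (R : realType) (q p : R) (hq : 2 <= q) (hqp : q <= p) :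
  exists c C : R, [/\ 0 < c, 0 < C &
    forall (d : nat) (Omega : set 'rV[R]_d)
      (mu : probability (borelRn R d) R) (F : set ('rV[R]_d -> R))
      (B : R) (m n : nat)
      (A : ('I_m -> 'rV[R]_d) -> set ('rV[R]_d -> R) ->
           ('rV[R]_d -> R) -> ('rV[R]_d -> R)),
      compact Omega -> mu Omega = 1%E -> compact_in_C Omega F ->
      1 <= B -> (0 < m)%N -> (0 < n)%N ->
      lpw Omega p A ->
      c * B `^ p * n%:R `^ (p / q) * ln (2 * B * n%:R) ^+ 3 <= m%:R ->
      (rho_lp mu Omega p A F <= C%:E * dNqB mu Omega q B n F)%E].
Proof.
have p2 : 2 <= p by lra.
have p1 : 1 <= p by lra.
have p0 : 0 < p by lra.
have q0 : 0 < q by lra.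
have [c0 [C0 [c00 C00 disc]]] := sampling_discretization p2.
pose C : R := (2 `^ (p - 1) * (C0 * 2 `^ p + 1)) `^ p^-1.
have CC0 : 0 < C.
  by rewrite powR_gt0 // mulr_gt0 ?powR_gt0 // addr_gt0 // mulr_gt0 ?powR_gt0.
exists (2 * (2 + p) ^+ 2 * 2 `^ (p / q) * c0 + 8), C; split => //.
  by rewrite addr_gt0 // !mulr_gt0 ?powR_gt0 //; lra.
move=> d Omega mu F B m n A cO muO [cF _] B1 m0 n0 hA hm.
have B0 : 0 <= B by lra.
have [K1 nK nm hmK] := sample_size hq hqp c00 B1 n0 hm.
set K := 2 `^ (p / q) * _ in K1 nK hmK.
apply: ereal_inf_pMl => // _ [X [[[e fe XE] Xc] XN] <-].
have Xa a : X (lincomb e a) by rewrite XE; exists a.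
have ca a : {within Omega, continuous (lincomb e a)} by exact: Xc.
have lincombZ a t : lincomb e (fun i => t * a i) = (fun x => t * lincomb e a x).
  apply/funext => x; rewrite /lincomb mulr_sumr.
  by apply: eq_bigr => i _; rewrite mulrA.
have be i : exists b : R, forall x, Omega x -> `|e i x| <= b.
  have eE : lincomb e (fun j => (j == i)%:R) = e i.
    apply/funext => x; rewrite /lincomb (bigD1 i) //= eqxx mul1r big1 ?addr0 //.
    by move=> j /negPf ->; rewrite mul0r.
  by rewrite -eE; exact: within_continuous_bounded.
have JK a x : Omega x ->
    `|lincomb e a x| `^ p <= K * pintegral Omega mu p (lincomb e a).
  by move=> Ox; apply: NqB_pintegral XN _ _ Ox.
have [xi Oxi hxi] : exists2 xi : 'I_m -> 'rV[R]_d, (forall j, Omega (xi j)) &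
    forall a, pintegral Omega mu p (lincomb e a) <=
      C0 * pmean p (fun j => lincomb e a (xi j)).
  apply: (disc d n m K Omega e (pintegral Omega mu p)) => //.
  - by move=> a; exact: pintegral_ge0.
  - by move=> a t; rewrite lincombZ pintegralZ //; exact: ltW.
  - by move=> a a' s s0 h; apply: pintegral_le => //; lra.
  - by move=> I a w _; apply: pintegral_select => //; exact: ltW.
have dimX : has_dim Omega n X by exists e.
have Lp : Lp_subspace mu Omega p n X.
  split=> // u Xu.
    have cu := Xc u Xu.
    rewrite /in_Lp; apply/andP; split; rewrite inE /=.
      apply/(measurable_restrictT _ (compact_borel cO)).
      exact: within_continuous_borel.
    rewrite /finite_norm.
    by have := Lp_normE cO muO p0 cu; rewrite /Lp_norm => ->; rewrite ltry.
  have cu := Xc u Xu; rewrite (Lp_normE cO muO p0 cu) => -[] /powR_eq0_eq0 J0 x Ox.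
  have : `|u x| `^ p <= K * pintegral Omega mu p u.
    by apply: NqB_pintegral XN _ _ Ox.
  rewrite J0 mulr0 => h; apply/eqP; rewrite -normr_eq0; apply/eqP.
  by apply: (@powR_eq0_eq0 _ _ p); apply/eqP; rewrite eq_le h powR_ge0.
have [x0 Ox0] : Omega !=set0.
  apply/set0P/negP => /eqP O0; move: muO; rewrite O0 measure0 => /eqP.
  by rewrite eqe eq_sym oner_eq0.
apply: le_trans (_ : ereal_sup [set Lp_norm mu Omega p (f \- A xi X f)%R | f in F] <= _)%E.
  apply: ereal_inf_lbound; exists xi, n, X; split=> //.
  by rewrite n0.
apply: ge_ereal_sup => _ [f Ff <-].
apply: le_trans (_ : C%:E * ereal_inf [set sup_norm Omega (f \- g)%R | g in X] <= _)%E.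
  apply: ereal_inf_pMl => // _ [g Xg <-].
  have argA := hA xi n X f Oxi dimX (cF f Ff).
  have XA : X (A xi X f) by case: argA.
  have fgS x : Omega x -> (`|f x - g x|%:E <= sup_norm Omega (f \- g)%R)%E.
    by move=> Ox; apply: ereal_sup_ubound; exists x.
  case: (sup_norm Omega (f \- g)) fgS => [s| |] fgS; last by have := fgS x0 Ox0.
    have fgs x : Omega x -> `|f x - g x| <= s by move=> Ox; rewrite -lee_fin; exact: fgS.
    have s0 : 0 <= s by apply: le_trans (fgs x0 Ox0).
    have gA : pintegral Omega mu p (g \- A xi X f) <=
        C0 * pmean p (fun j => g (xi j) - A xi X f (xi j)).
      move: Xg XA; rewrite XE => -[a _ <-] [a' _ <-].
      have lincombB x : lincomb e a x - lincomb e a' x =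
          lincomb e (fun i => a i - a' i) x.
        by rewrite /lincomb -sumrB; apply: eq_bigr => i _; rewrite mulrBl.
      rewrite (_ : _ \- _ = lincomb e (fun i => a i - a' i)); last exact/funext.
      apply: le_trans (hxi _) _; rewrite le_eqVlt; apply/orP; left; apply/eqP.
      by congr (_ * pmean _ _); apply/funext => j; rewrite lincombB.
    rewrite -EFinM.
    exact: (recovery_error cO muO p1 C00 s0 m0 Oxi (cF f Ff) (Xc g Xg) (Xc _ XA)
      gA argA Xg fgs).
  by rewrite gt0_muley ?lte_fin // leey.
rewrite lee_pmul2l ?lte_fin //.
by apply: ereal_sup_ubound; exists f.
Qed.
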